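(* Let $(a,b,m,n)\in\mathcal Q$ and assume $m\le n$. Assume that $F\in R_{m,n}$, $G\in R_{bm/a,\,bn/a}$, and $[F,G]\in\mathbb C$. Let $\zeta(F)$ be the inner polynomial of $F$ (that is, of the pair $(F,a)$). Then either $\zeta(F)=0$, or there exists a lattice point $(m',n')$ such that (1) $\zeta(F)\in\overline R_{m',n'}$; (2) $(m',n')\in\mathfrak R:=\{(x,y)\in\mathbb R^2 : 0\le y<\frac{a-1}{a}n \text{ and } \mathfrak m\,(x-\frac{a}{a+b})+\frac{a}{a+b}\le y\le \frac nm x\}$, where $\mathfrak m=(n-\frac{a}{a+b})/(m-\frac{a}{a+b})$ is the slope of the line through $(m,n)$ and $C:=(\frac{a}{a+b},\frac{a}{a+b})$.
   Context: $\mathcal R=\mathbb C[x,y]$ and $[f,g]=\frac{\partial f}{\partial x}\frac{\partial g}{\partial y}-\frac{\partial f}{\partial y}\frac{\partial g}{\partial x}$ for $f,g\in\mathcal R$. For $f=\sum f_{ij}x^iy^j\in\mathcal R$, $\mathrm{supp}(f)=\{(i,j): f_{ij}\ne0\}$, and $N^0(f)$ is the convex hull of $\mathrm{supp}(f)\cup\{(0,0)\}$. For nonnegative integers $m,n$, $\mathrm{Rect}_{m,n}$ is the convex hull of $\{(0,0),(m,0),(m,n),(0,n)\}$. For each pair $(m,n)\in\mathbb Z_{>0}^2$: $R_{m,n}$ is the set of $f\in\mathcal R$ with $N^0(f)=\mathrm{Rect}_{m,n}$ and coefficient of $x^my^n$ in $f$ equal to $1$; $\overline R_{m,n}$ is the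 set of $f\in\mathcal R$ with $N^0(f)\subseteq\mathrm{Rect}_{m,n}$ and nonzero coefficient of $x^my^n$ in $f$. $\mathcal Q=\{(a,b,m,n)\in\mathbb Z_{>0}^4 : a\mid m,\ a\mid n,\ \gcd(a,b)=1,\ 2\le a<b\}$. Given $F\in R_{m,n}$, let $\mathcal N''=\mathrm{Rect}_{m/a,n/a}+\frac{a-1}{a}(m,n)=[\frac{a-1}{a}m,m]\times[\frac{a-1}{a}n,n]$. The pre-generator $Q$ of the pair $(F,a)$ is the unique polynomial $Q\in R_{m/a,n/a}$ such that $\mathrm{supp}(F-Q^a)\subseteq N^0(F)\setminus\mathcal N''$. The inner polynomial of the pair $(F,a)$ (also called the inner polynomial of $F$) is $\zeta(F):=F-Q^a$.
   Formalization: The set R̄_{m',n'} is also allowed for (m',n')=(0,0), not only for positive m',n': if ζ(F) is a nonzero constant (e.g. F=Q^a+1, G=Q^b, [F,G]=0), no positive pair works. *)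

(* Defs.v *)
From mathcomp Require Import all_boot all_order all_algebra.
From mathcomp Require Import complex.
From mathcomp Require Import boolp classical_sets reals.

Set Implicit Arguments.
Unset Strict Implicit.
Unset Printing Implicit Defensive.

Import Order.TTheory GRing.Theory Num.Theory.

Local Open Scope classical_set_scope.
Local Open Scope ring_scope.

(* The complex numbers are [R[i]] for a [realType] R.  As in polyXY, C[x,y] is
   {poly {poly C}} with x the outer and y the inner variable, so that the
   coefficient of x^i y^j in f is [f`_i`_j]. *)
Notation Cxy R := {poly {poly R[i]}}.

Definition dx (R : realType) (f : Cxy R) : Cxy R := f^`().

Definition dy (R : realType) (f : Cxy R) : Cxy R :=
  map_poly (fun p : {poly R[i]} => p^`()) f.

Definition bracket (R : realType) (f g : Cxy R) : Cxy R :=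
  dx f * dy g - dy f * dx g.

Definition is_constXY (R : realType) (f : Cxy R) : Prop :=
  exists c : R[i], f = c%:P%:P.

Definition pt (R : realType) (q : nat * nat) : R * R := (q.1%:R, q.2%:R).

Definition conv_hull (R : realType) (S : set (R * R)) : set (R * R) :=
  [set p | exists (k : nat) (t : 'I_k -> R) (v : 'I_k -> R * R),
     [/\ forall i, 0 <= t i,
         \sum_(i < k) t i = 1,
         forall i, S (v i) &
         p = (\sum_(i < k) t i * (v i).1, \sum_(i < k) t i * (v i).2)]].

Definition supp (R : realType) (f : Cxy R) : set (nat * nat) :=
  [set q | f`_(q.1)`_(q.2) != 0].

Definition N0 (R : realType) (f : Cxy R) : set (R * R) :=
  conv_hull ((@pt R @` supp f) `|` [set (0, 0)]).

Definition Rect (R : realType) (m n : nat) : set (R * R) :=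
  conv_hull (@pt R @` [set (0, 0)%N; (m, 0)%N; (m, n); (0, n)%N]).

Definition Rset (R : realType) (m n : nat) : set (Cxy R) :=
  [set f | N0 f = Rect m n /\ f`_m`_n = 1].

(* Also used for m = 0 or n = 0: if the inner polynomial is a nonzero constant,
   as for F = Q^a + 1 and G = Q^b, the only possible corner is (0, 0). *)
Definition Rbar (R : realType) (m n : nat) : set (Cxy R) :=
  [set f | N0 f `<=` Rect m n /\ f`_m`_n != 0].

Definition calQ (a b m n : nat) : Prop :=
  [/\ [/\ 0 < a, 0 < b, 0 < m & 0 < n],
      a %| m, a %| n, coprime a b & 2 <= a < b]%N.

Definition N'' (R : realType) (a m n : nat) : set (R * R) :=
  [set (p.1 + (a%:R - 1) / a%:R * m%:R, p.2 + (a%:R - 1) / a%:R * n%:R)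
     | p in Rect (m %/ a) (n %/ a)].

(* At most one Q satisfies this: the condition fixes the coefficients of Q
   successively, starting from the top corner. *)
Definition is_pregenerator (R : realType) (a m n : nat) (F Q : Cxy R) : Prop :=
  Rset (m %/ a) (n %/ a) Q /\
  @pt R @` supp (F - Q ^+ a) `<=` N0 F `\` N'' a m n.

Definition is_inner (R : realType) (a m n : nat) (F zeta : Cxy R) : Prop :=
  exists2 Q : Cxy R, is_pregenerator a m n F Q & zeta = F - Q ^+ a.

Definition frakR (R : realType) (a b m n : nat) : set (R * R) :=
  let c : R := a%:R / (a + b)%:R in
  let slope : R := (n%:R - c) / (m%:R - c) in
  [set p : R * R | 0 <= p.2 < (a%:R - 1) / a%:R * n%:R /\
                   slope * (p.1 - c) + c <= p.2 <= n%:R / m%:R * p.1].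

(* Main.v *)
Require Import Defs.
From HB Require Import structures.
From mathcomp Require Import all_boot all_order all_algebra.
From mathcomp Require Import zify ring lra.
From mathcomp Require Import complex.
From mathcomp Require Import boolp classical_sets reals.

(** Consider first the poles of [F], [G], [Q] and [zeta = F - Q ^+ a] along the
    line at infinity where [y] is infinite and [x] is finite; the pole orders are
    the degrees in [y]. Blow up a point of this divisor, then a point of the new
    divisor, and so on, in other words substitute initial segments of a Puiseux
    expansion of [x] in [1 / y]. Along the way the pole order of a polynomial
    decreases at a rate given by the number of its roots, as a polynomial in [x],
    that belong to the branch chosen.

    As long as the pole orders of [F] and [G] together exceed that of the volume
    form, the equation [bracket F G = const] says that the leading forms of [F]
    and [G] along the divisor commute. The pole orders are in the ratio [a : b],
    with [a] and [b] coprime, so the leading form of [F] is an [a]-th power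
    ([power_of_coprime_relation]). While [zeta] has the smaller pole this is the
    [a]-th power of the leading form of [Q], and nothing is learnt. But [zeta]
    cannot catch up with [F] ([node_d_gt0]): then [R ^+ a = q ^+ a + z] for the
    leading forms, so [z] is zero or has degree at least [(a - 1) / a] times that
    of [R ^+ a] ([close_powers]), and the branch can be chosen so that it has too
    few roots of [zeta] for that.

    The choice of the branch is a pigeonhole argument ([root_with_slack]): if the
    top row of [zeta] has small degree in [x], measured against its degree in [y],
    then the same holds at some root, hence forever, and [zeta] has to catch up
    with [F] ([node_step], [no_node]). The result, [error_not_slack], is a lower
    bound for the degree of the top row of [zeta] and, exchanging the variables,
    of its rightmost column.

    The first bound puts the end of the top row to the right of the diagonal from
    the origin to [(m, n)], at a height below [(a - 1) / a * n]; the second puts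
    the top of the rightmost column above the line through [C] and [(m, n)].
    These lines bound a strip of horizontal width less than one, and therefore
    the two lattice points are equal ([corner_arith]). The common point dominates
    the support of [zeta], so it is the corner asked for. *)

Set Implicit Arguments.
Unset Strict Implicit.
Unset Printing Implicit Defensive.

Import Order.TTheory GRing.Theory Num.Theory.

Local Open Scope ring_scope.

(** * Polynomials in one variable over an algebraically closed field *)

Section Univariate.
Variable K : numClosedFieldType.
Implicit Types (A B f g q z R : {poly K}).

Lemma natr_neq0 n : (0 < n)%N -> n%:R != 0 :> K.
Proof. by rewrite pnatr_eq0 lt0n. Qed.

(** The two products have leading terms with coefficients proportional to
    [deg A] and [deg B], so in characteristic zero the degrees agree. *)
Lemma size_eq_of_log_deriv A B :
  A != 0 -> B != 0 -> A^`() * B = A * B^`() -> size A = size B.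
Proof.
move=> A0 B0 h.
have sA : (0 < size A)%N by rewrite size_poly_gt0.
have sB : (0 < size B)%N by rewrite size_poly_gt0.
have key (P Q : {poly K}) : P != 0 -> Q != 0 ->
    (P^`() * Q)`_((size P).-1 + (size Q).-1).-1
      = lead_coef P * lead_coef Q *+ (size P).-1.
  move=> P0 Q0.
  have [s1|s1] := eqVneq (size P) 1%N.
    have /size_poly1P [c _ ->] : size P == 1%N by rewrite s1.
    rewrite derivC mul0r coef0.
    by rewrite size_polyC; case: (c == 0) => /=; rewrite mulr0n.
  have sP : (1 < size P)%N by rewrite ltn_neqAle eq_sym s1 size_poly_gt0.
  rewrite coefM.
  have hi : ((size P).-2 < ((size P).-1 + (size Q).-1).-1.+1)%N by lia.
  rewrite (bigD1 (Ordinal hi)) //= big1 ?addr0.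
    rewrite coef_deriv.
    have -> : (size P).-2.+1 = (size P).-1 by lia.
    have -> : (((size P).-1 + (size Q).-1).-1 - (size P).-2)%N = (size Q).-1.
      by lia.
    by rewrite mulrnAl.
  move=> i /eqP ni.
  have {}ni : (i : nat) <> (size P).-2 by move=> e; apply: ni; apply: val_inj.
  have [li|li] := ltnP i (size P).-2.
    rewrite [Q`__]nth_default ?mulr0 //.
    by move: (size P) (size Q) (nat_of_ord i) li => x y w; lia.
  rewrite coef_deriv [P`__]nth_default ?mul0rn ?mul0r //.
  by move: (size P) (nat_of_ord i) li ni => x w; lia.
have e1 := key A B A0 B0; have e2 := key B A B0 A0.
have : lead_coef A * lead_coef B *+ (size A).-1
     = lead_coef A * lead_coef B *+ (size B).-1.
  by rewrite -e1 h [A * _]mulrC addnC e2 [lead_coef B * _]mulrC.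
rewrite -[LHS]mulr_natr -[RHS]mulr_natr => /mulfI.
rewrite mulf_neq0 ?lead_coef_eq0 // => /(_ isT) /eqP.
by rewrite eqr_nat => /eqP; lia.
Qed.

(** Vanishing of the Wronskian forces proportionality: subtracting the multiple
    of [B] that cancels the leading term of [A] leaves a polynomial of smaller
    degree with the same logarithmic derivative as [B]. *)
Lemma proportional_of_log_deriv A B :
  A != 0 -> B != 0 -> A^`() * B = A * B^`() ->
  exists2 c : K, c != 0 & A = c *: B.
Proof.
move=> A0 B0 h.
have lB : lead_coef B != 0 by rewrite lead_coef_eq0.
exists (lead_coef A / lead_coef B).
  by rewrite mulf_neq0 ?invr_eq0 ?lead_coef_eq0.
set c := _ / _; apply/eqP; rewrite -subr_eq0; apply/negPn/negP => D0.
have sAB := size_eq_of_log_deriv A0 B0 h.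
have hD : (A - c *: B)^`() * B = (A - c *: B) * B^`().
  by rewrite derivB derivZ !mulrBl h -!scalerAl [B^`() * B]mulrC.
have sD := size_eq_of_log_deriv D0 B0 hD.
have : (size (A - c *: B)%R < size B)%N.
  have sB : (0 < size B)%N by rewrite size_poly_gt0.
  suff : (size (A - c *: B)%R <= (size B).-1)%N by lia.
  apply/leq_sizeP => j hj.
  rewrite coefB coefZ.
  have [->|nj] := eqVneq j (size B).-1.
    by rewrite -{1}sAB -!lead_coefE divfK // subrr.
  have hB : (size B <= j)%N by move: (size B) sB hj nj => s; lia.
  by rewrite !nth_default ?mulr0 ?subr0 // sAB.
by rewrite sD ltnn.
Qed.

(** The hypothesis says that [g ^+ a] and [f ^+ b] have the same logarithmic
    derivative. *)
Lemma power_relation a b f g : (0 < a)%N -> (0 < b)%N ->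
  f != 0 -> g != 0 -> f * g^`() *+ a = f^`() * g *+ b ->
  exists2 c : K, c != 0 & g ^+ a = c *: f ^+ b.
Proof.
move=> a0 b0 f0 g0 h.
apply: proportional_of_log_deriv; rewrite ?expf_neq0 //.
rewrite !deriv_exp -(prednK a0) -(prednK b0) /= in h *.
rewrite !mulrnAl !mulrnAr.
transitivity (g ^+ a.-1 * f ^+ b.-1 * (f * g^`() *+ a.-1.+1)).
  by rewrite [f ^+ b.-1.+1]exprS -mulrnAr; ring.
by rewrite h [g ^+ a.-1.+1]exprS; ring.
Qed.

(** Bezout: if [a * u = b * v + 1] then [f * (g ^+ v) ^+ a] is, up to a
    constant, the [a]-th power of [f ^+ u]. *)
Lemma power_of_coprime_relation a b (c : K) f g : (0 < a)%N -> coprime a b ->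
  f != 0 -> g != 0 -> c != 0 -> g ^+ a = c *: f ^+ b ->
  exists R, f = R ^+ a.
Proof.
move=> a0 cab f0 g0 c0 h.
have [u v e _] := egcdnP b a0.
rewrite (eqP cab) in e.
have [d dE] : exists d : K, d ^+ a = c ^+ v.
  by exists (a.-root (c ^+ v)); rewrite rootCK.
have key : f * (g ^+ v) ^+ a = (d *: f ^+ u) ^+ a.
  rewrite exprAC h exprZn -scalerAr exprZn dE; congr (_ *: _).
  by rewrite -!exprM e -exprS mulnC addn1.
have : g ^+ v %| d *: f ^+ u.
  by rewrite -(dvdp_pexp2r _ _ a0) -key dvdp_mull.
move=> /dvdpP [r rE]; exists r.
rewrite rE exprMn in key.
by apply: (mulIf _ key); rewrite !expf_neq0.
Qed.

(** Two polynomials whose [a]-th powers differ by little are equal up to a root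
    of unity: after normalizing the leading coefficients, the cofactor of
    [R - q] in [R ^+ a - q ^+ a] has full degree [(a - 1) * L]. *)
Lemma close_powers a L R q z : (0 < a)%N -> (0 < L)%N ->
  size R = L.+1 -> z != 0 -> (size z <= (a.-1 * L))%N ->
  R ^+ a = q ^+ a + z -> False.
Proof.
move=> a0 L0 sR z0 sz h.
have R0 : R != 0 by rewrite -size_poly_gt0 sR.
have sRa : size (R ^+ a) = (a * L).+1.
  have := size_exp R a; rewrite sR /= => e.
  by rewrite -(@prednK (size _)) ?size_poly_gt0 ?expf_neq0 // e mulnC.
have sqa : size (q ^+ a) = (a * L).+1.
  have -> : q ^+ a = R ^+ a - z by rewrite h addrK.
  rewrite size_polyDl sRa // size_polyN; apply: leq_ltn_trans sz _.
  by rewrite ltnS leq_mul // leq_pred.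
have q0 : q != 0.
  apply: contraTneq isT => q0; move: sqa.
  by rewrite q0 expr0n gtn_eqF // size_poly0.
have sq : size q = L.+1.
  have := size_exp q a; rewrite sqa /= => /eqP; rewrite mulnC eqn_pmul2r // => /eqP e.
  by rewrite -(@prednK (size q)) ?size_poly_gt0 // -e.
have lc : lead_coef R ^+ a = lead_coef q ^+ a.
  rewrite -!lead_coef_exp h lead_coefDl // sqa; apply: leq_ltn_trans sz _.
  by rewrite ltnS leq_mul // leq_pred.
have lR0 : lead_coef R != 0 by rewrite lead_coef_eq0.
pose w := lead_coef q / lead_coef R.
have wa : w ^+ a = 1 by rewrite expr_div_n -lc divff // expf_neq0.
have w0 : w != 0 by rewrite mulf_neq0 ?invr_eq0 // lead_coef_eq0.
pose S := w *: R.
have Sa : S ^+ a = R ^+ a by rewrite exprZn wa scale1r.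
have zE : z = (S - q) * \sum_(i < a) S ^+ (a.-1 - i) * q ^+ i.
  by rewrite -subrXX Sa h addrC addKr.
have cS i : (i <= a.-1)%N ->
    (S ^+ (a.-1 - i) * q ^+ i)`_(a.-1 * L) = lead_coef q ^+ a.-1.
  move=> hi.
  have S0 : S != 0 by rewrite scaler_eq0 negb_or w0.
  have sS : size S = L.+1 by rewrite size_scale.
  have lS : lead_coef S = lead_coef q by rewrite lead_coefZ divfK.
  have <- : lead_coef (S ^+ (a.-1 - i) * q ^+ i) = lead_coef q ^+ a.-1.
    by rewrite lead_coefM !lead_coef_exp lS -exprD subnK.
  rewrite lead_coefE size_mul ?expf_neq0 //.
  have -> : (size (S ^+ (a.-1 - i))%R + size (q ^+ i)%R).-2 = (a.-1 * L)%N => [|//].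
  have pos (P : {poly K}) n : P != 0 -> size (P ^+ n) = ((size P).-1 * n).+1.
    by move=> P0; rewrite -size_exp prednK // size_poly_gt0 expf_neq0.
  rewrite !pos // sS sq /=.
  nia.
have big : (a.-1 * L < size (\sum_(i < a) S ^+ (a.-1 - i) * q ^+ i)%R)%N.
  rewrite ltnNge; apply/negP => /leq_sizeP /(_ _ (leqnn _)) /eqP.
  rewrite coef_sum (eq_bigr (fun=> lead_coef q ^+ a.-1)) => [|i _]; last first.
    by rewrite cS // -ltnS prednK.
  rewrite sumr_const card_ord -mulr_natr mulf_eq0 (negPf (natr_neq0 a0)) orbF.
  by rewrite expf_eq0 lead_coef_eq0 (negPf q0) andbF.
have Sq : S - q != 0 by apply: contraNneq z0 => e; rewrite zE e mul0r.
have big0 : \sum_(i < a) S ^+ (a.-1 - i) * q ^+ i != 0.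
  by rewrite -size_poly_gt0; apply: leq_ltn_trans big.
have : size z = (size (S - q)%R + size (\sum_(i < a) S ^+ (a.-1 - i) * q ^+ i)%R).-1.
  by rewrite zE size_mul.
have : (0 < size (S - q)%R)%N by rewrite size_poly_gt0.
by move: big sz; lia.
Qed.

Lemma mupX x q n : q != 0 -> mup x (q ^+ n) = (n * mup x q)%N.
Proof.
move=> q0; elim: n => [|n IH].
  by rewrite expr0 mul0n mupNroot // rootE hornerC oner_eq0.
by rewrite exprS mupM ?expf_neq0 // IH mulSn.
Qed.

(** The distinct roots of [q], on which the multiplicities of any other
    polynomial [z] add up to at most its degree. *)
Lemma sum_mup_size q : q != 0 ->
  exists s : seq K, [/\ uniq s,
    (\sum_(x <- s) mup x q = (size q).-1)%N &
    forall z, z != 0 -> (\sum_(x <- s) mup x z <= (size z).-1)%N].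
Proof.
move=> q0; have [r qE] := closed_field_poly_normal q.
have lq : lead_coef q != 0 by rewrite lead_coef_eq0.
have part (s : seq K) z : uniq s -> z != 0 ->
   (\sum_(x <- s) mup x z <= (size z).-1)%N.
  move=> us z0; have [t zE] := closed_field_poly_normal z.
  have lz : lead_coef z != 0 by rewrite lead_coef_eq0.
  have mz x : mup x z = count_mem x t.
    rewrite zE -mul_polyC mupMr ?mu_prod_XsubC //.
    by rewrite rootC.
  rewrite zE size_scale // size_prod_XsubC /= -zE.
  rewrite (eq_bigr (fun x => count_mem x t)) => [|x _]; last exact: mz.
  elim: s us => [|x s IH] /=; first by rewrite big_nil.
  move=> /andP [xs us].
  have cnt : (\sum_(x <- s) count_mem x t = count (mem s) t)%N.
    elim: s xs us {IH} => [_ _|y s IH]; first by rewrite big_nil; elim: t {zE mz}.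
    rewrite inE negb_or => /andP [_ xs] /= /andP [ys us].
    rewrite big_cons IH //.
    rewrite -count_predUI.
    rewrite [X in (_ + X)%N](_ : _ = 0%N) ?addn0.
      by apply: eq_count => i /=; rewrite inE.
    rewrite -(count_pred0 t); apply: eq_count => i /=.
    by apply/negbTE/negP => /andP [/eqP -> ]; rewrite (negPf ys).
  rewrite big_cons cnt -count_predUI.
  rewrite [X in (_ + X)%N](_ : _ = 0%N) ?addn0 ?count_size //.
  rewrite -(count_pred0 t); apply: eq_count => i /=.
  by apply/negbTE/negP => /andP [/eqP -> ]; rewrite (negPf xs).
have mq x : mup x q = count_mem x r.
  rewrite qE -mul_polyC mupMr ?mu_prod_XsubC //.
  by rewrite rootC.
exists (undup r); split.
- exact: undup_uniq.
- rewrite qE size_scale // size_prod_XsubC /= -qE.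
  rewrite (eq_bigr (fun x => count_mem x r)) => [|x _]; last exact: mq.
  rewrite -sum1_size -(big_undup_iterop_count _ r) /=.
  by apply: eq_bigr => i _; rewrite Monoid.iteropE iter_addn_0 mul1n.
- by move=> z z0; apply: part => //; apply: undup_uniq.
Qed.

Lemma mup_full_power q x : q != 0 -> (mup x q).+1 = size q ->
  exists2 c : K, c != 0 & q = c *: ('X - x%:P) ^+ mup x q.
Proof.
move=> q0 e.
have /dvdpP [r rE] : ('X - x%:P) ^+ mup x q %| q by rewrite -mup_geq.
have r0 : r != 0 by apply: contraNneq q0 => r0; rewrite rE r0 mul0r.
have : size r == 1%N.
  have : size q = (size r + size (('X - x%:P) ^+ mup x q)%R).-1.
    by rewrite {1}rE size_mul // expf_neq0 // polyXsubC_eq0.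
  rewrite size_exp_XsubC -e.
  have : (0 < size r)%N by rewrite size_poly_gt0.
  by move=> ? ?; apply/eqP; lia.
by move/size_poly1P => [c c0 cE]; exists c => //; rewrite {1}rE cE mul_polyC.
Qed.

Lemma coef_shift_mup q x : q != 0 ->
  (forall i, (i < mup x q)%N -> (q \Po ('X + x%:P))`_i = 0) /\
  (q \Po ('X + x%:P))`_(mup x q) != 0.
Proof.
move=> q0.
have /dvdpP [r rE] : ('X - x%:P) ^+ mup x q %| q by rewrite -mup_geq.
have e : q \Po ('X + x%:P) = (r \Po ('X + x%:P)) * 'X^(mup x q).
  by rewrite {1}rE comp_polyM rmorphXn /= comp_polyB comp_polyX comp_polyC addrK.
split=> [i hi|]; rewrite e coefMXn; first by rewrite hi.
rewrite ltnn subnn -horner_coef0 horner_comp !hornerE.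
apply/negP => /eqP rx.
have : ('X - x%:P) ^+ (mup x q).+1 %| q.
  by rewrite {2}rE exprS dvdp_mul // dvdp_XsubCl; apply/rootP.
by rewrite -mup_geq // ltnn.
Qed.

End Univariate.

(** * Choosing a branch *)

(** For totals [L] and [P], the two hypotheses say that [P] lies below
    [L |-> min (v L / u, (w L + d) / c)]. As [d >= 0], this function is concave
    and nonnegative at zero, hence subadditive, so some summand lies below it. *)
Lemma pigeonhole_two_slopes (T : eqType) (s : seq T) (l p : T -> nat)
    (u v c w d : int) : 0 < u -> 0 < c -> 0 <= d ->
  u * \sum_(x <- s) (p x)%:Z < v * \sum_(x <- s) (l x)%:Z ->
  c * \sum_(x <- s) (p x)%:Z < w * \sum_(x <- s) (l x)%:Z + d ->
  exists2 x, x \in s &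
    u * (p x)%:Z < v * (l x)%:Z /\ c * (p x)%:Z < w * (l x)%:Z + d.
Proof.
move=> u0 c0 d0 h1 h2.
have [/hasP [x xs /andP [g1 g2]]|/hasPn no] :=
  boolP (has (fun x => (u * (p x)%:Z < v * (l x)%:Z)
                    && (c * (p x)%:Z < w * (l x)%:Z + d)) s).
  by exists x.
have no' x : x \in s -> v * (l x)%:Z <= u * (p x)%:Z
                     \/ w * (l x)%:Z + d <= c * (p x)%:Z.
  by move=> /no; rewrite negb_and -!leNgt => /orP.
have all1 : (forall x, x \in s -> v * (l x)%:Z <= u * (p x)%:Z) -> False.
  move=> h; suff : v * \sum_(x <- s) (l x)%:Z <= u * \sum_(x <- s) (p x)%:Z.
    by move=> /le_lt_trans /(_ h1); rewrite ltxx.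
  by rewrite !mulr_sumr big_seq [leRHS]big_seq; apply: ler_sum.
(* Suppose that at every summand one of the inequalities fails. If
   [v / u <= w / c], the first fails everywhere. Otherwise [w * l <= c * p]
   everywhere, and where the second fails there is the extra term [d]. *)
have [wv|vw] := leP (v * c) (w * u).
  exfalso; apply: all1 => x /no' [//|h].
  have := lez_nat 0 (l x); have := lez_nat 0 (p x) => /= *; nia.
have ge x : x \in s -> w * (l x)%:Z <= c * (p x)%:Z.
  move=> /no' [h|h]; last by lia.
  nia.
have [/hasP [x xs hx]|/hasPn none] :=
  boolP (has (fun x => w * (l x)%:Z + d <= c * (p x)%:Z) s).
  exfalso; suff : w * \sum_(x <- s) (l x)%:Z + d <= c * \sum_(x <- s) (p x)%:Z.
    by move=> /le_lt_trans /(_ h2); rewrite ltxx.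
  rewrite !(perm_big _ (perm_to_rem xs)) /= !big_cons !mulrDr addrAC.
  apply: lerD => //; rewrite !mulr_sumr big_seq [leRHS]big_seq.
  by apply: ler_sum => y /mem_rem /ge.
exfalso; apply: all1 => x xs; case: (no' x xs) => // h.
by have := none x xs; rewrite h.
Qed.

(** Here [a * k] and [a * k - d] are the pole orders of [F] and of the error term
    [zeta] along the current divisor, and [a * l] and [p] count their zeros on the
    branch still to be followed. Along a path of blow-ups a pole order decreases
    at the rate of this count. The second inequality therefore says that the pole
    of [zeta] overtakes that of [F] before the latter disappears, the third that
    this happens before [E], the excess of the pole orders of [F] and [G] over
    that of the volume form, is used up; [E] decreases at the rate
    [(a + b) * l - 1]. *)
Definition slack (a b k E d l p : nat) : Prop :=
  [/\ (p < a.-1 * l)%N, (d * l + p * k < a * l * k)%N &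
      (d * ((a + b) * l) + p * E < a * l * E + d)%N].

(** [slack] is inherited by at least one of the points over which the branches of
    [q] separate. *)
Lemma root_with_slack (K : numClosedFieldType) a b k E d (q z : {poly K}) :
  q != 0 -> z != 0 -> (0 < a)%N -> (0 < k)%N -> (0 < E)%N ->
  slack a b k E d (size q).-1 (size z).-1 ->
  exists x, slack a b k E d (mup x q) (mup x z).
Proof.
move=> q0 z0 a0 k0 E0 [h1 h2 h3].
have [s [_ sq sz]] := sum_mup_size q0; have {}sz := sz z z0.
(* Only the stronger of the two homogeneous bounds on [p / l] matters. *)
have [u [v [u0 uv1 uv2]]] : exists u v : int, [/\ 0 < u,
    forall l p : nat, u * p%:Z < v * l%:Z ->
      (p < a.-1 * l)%N /\ (d * l + p * k < a * l * k)%N &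
    forall l p : nat, (p < a.-1 * l)%N -> (d * l + p * k < a * l * k)%N ->
     u * p%:Z < v * l%:Z].
  have [kd|dk] := leP k d.
    exists k%:Z, (a%:Z * k%:Z - d%:Z); split=> [//|l p h|l p ha hb].
      by split; nia.
    by nia.
  exists 1, (a.-1)%:Z; split=> [//|l p h|l p ha hb].
    by split; nia.
  by nia.
have [] := @pigeonhole_two_slopes K s (fun x : K => mup x q)
   (fun x : K => mup x z) u v E%:Z
   (a%:Z * E%:Z - d%:Z * (a + b)%:Z) d%:Z => //.
- rewrite -!(big_morph Posz PoszD (erefl _)) sq.
  by apply: le_lt_trans (uv2 _ _ h1 h2); rewrite ler_pM2l // lez_nat.
- rewrite -!(big_morph Posz PoszD (erefl _)) sq.
  move: sz h3; clear -K.
  by move: (\sum_(i <- s) mup i z)%N (size z).-1 (size q).-1 => S Z L *; nia.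
move=> x _ [/uv1 [g1 g2] g3]; exists x; split=> //.
by nia.
Qed.

(** * Brackets and substitutions in two variables *)

(** The substitution [x := x * t ^ p], [t := t ^ q], a weighted blow-up of the
    origin. *)
HB.lock Definition stretch (R : comNzRingType) (p q : nat) :
    {poly {poly R}} -> {poly {poly R}} :=
  swapXY \o comp_poly ('X * ('X^p)%:P) \o swapXY \o comp_poly 'X^q.

Section Bivariate.
Variable R : comNzRingType.
Implicit Types (f g h : {poly {poly R}}).

Definition inner_deriv f : {poly {poly R}} := map_poly (@deriv R) f.

Lemma coef_inner_deriv f j : (inner_deriv f)`_j = (f`_j)^`().
Proof. by rewrite coef_map. Qed.

Lemma inner_deriv_swap f : inner_deriv f = swapXY (swapXY f)^`().
Proof.
apply/polyP => j; apply/polyP => i.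
by rewrite coef_swapXY coef_deriv coefMn coef_swapXY coef_inner_deriv coef_deriv.
Qed.

Lemma inner_derivM f g : inner_deriv (f * g) = inner_deriv f * g + f * inner_deriv g.
Proof.
by rewrite !inner_deriv_swap rmorphM /= derivM rmorphD !rmorphM /= !swapXYK.
Qed.

Lemma inner_deriv_Xn n : inner_deriv 'X^n = 0.
Proof.
apply/polyP => j; rewrite coef_inner_deriv coefXn coef0.
by case: (j == n); rewrite ?derivC // -polyC1 derivC.
Qed.

(** The operator [t * d/dt] seen through multiplication by [t ^ (- N)]. *)
Definition euler N f := 'X * f^`() - f *+ N.

(** For [F = t^(-N) f] and [G = t^(-M) g] this is [t^(N+M)] times the bracket of
    [F] and [G] for the derivations [d/dx] and [t * d/dt]. *)
Definition jac N M f g := inner_deriv f * euler M g - euler N f * inner_deriv g.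

Lemma euler_mulXn N e f : euler (N + e) (f * 'X^e) = 'X^e * euler N f.
Proof.
rewrite /euler derivM derivXn mulrnDr.
case: e => [|e]; first by rewrite !expr0 !mulr0n; ring.
by rewrite /= exprS; ring.
Qed.

Lemma jac_mulXn N M d e f g :
  jac (N + d) (M + e) (f * 'X^d) (g * 'X^e) = 'X^(d + e) * jac N M f g.
Proof.
rewrite /jac !euler_mulXn !inner_derivM !inner_deriv_Xn !mulr0 !addr0 exprD; ring.
Qed.

Definition shiftx (x : R) : {poly {poly R}} -> {poly {poly R}} :=
  map_poly (comp_poly ('X + x%:P)).
HB.instance Definition _ x := GRing.RMorphism.copy (shiftx x)
  (map_poly (comp_poly ('X + x%:P))).

Lemma coef_shiftx x f j : (shiftx x f)`_j = f`_j \Po ('X + x%:P).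
Proof. by rewrite coef_map. Qed.

Lemma shiftxXn x n : shiftx x 'X^n = 'X^n.
Proof. by rewrite /shiftx map_polyXn. Qed.

Lemma shiftxC x (c : R) : shiftx x c%:P%:P = c%:P%:P.
Proof. by rewrite /shiftx map_polyC /= comp_polyC. Qed.

Lemma inner_deriv_shiftx x f : inner_deriv (shiftx x f) = shiftx x (inner_deriv f).
Proof.
apply/polyP => j; rewrite coef_inner_deriv !coef_shiftx coef_inner_deriv deriv_comp.
by rewrite derivD derivX derivC addr0 mulr1.
Qed.

Lemma jac_shiftx x N M f g :
  jac N M (shiftx x f) (shiftx x g) = shiftx x (jac N M f g).
Proof.
have eu L h : euler L (shiftx x h) = shiftx x (euler L h).
  rewrite /euler rmorphB rmorphM rmorphMn /= -['X]expr1 shiftxXn expr1.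
  by rewrite /shiftx deriv_map.
by rewrite /jac !eu !inner_deriv_shiftx [RHS]rmorphB /= !rmorphM.
Qed.

Lemma stretchB p q f g :
  stretch p q (f - g) = stretch p q f - stretch p q g.
Proof.
by rewrite stretch.unlock /= comp_polyB swapXY_is_zmod_morphism comp_polyB
  swapXY_is_zmod_morphism.
Qed.

Lemma stretchM p q f g :
  stretch p q (f * g) = stretch p q f * stretch p q g.
Proof.
by rewrite stretch.unlock /= comp_polyM (swapXY_is_multiplicative R).1 comp_polyM
  (swapXY_is_multiplicative R).1.
Qed.

Lemma coef_stretch p q f e i : (0 < q)%N ->
  (stretch p q f)`_e`_i =
    if (p * i <= e)%N && (q %| e - p * i)%N then f`_((e - p * i) %/ q)`_i
    else 0.
Proof.
move=> q0; rewrite stretch.unlock /= coef_swapXY.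
set h := swapXY _.
have -> : (h \Po 'X * ('X^p)%:P)`_i = h`_i * 'X^(p * i).
  rewrite coef_comp_poly.
  have [hi|hi] := ltnP i (size h).
    rewrite (bigD1 (Ordinal hi)) //= big1 ?addr0.
      by rewrite exprMn -rmorphXn /= coefMC coefXn eqxx mul1r exprM.
    move=> j /eqP ji; rewrite exprMn -rmorphXn /= coefMC coefXn.
    case: eqP => [e'|]; last by rewrite mul0r mulr0.
    by case: ji; apply: val_inj.
  rewrite big1 => [|j _]; first by rewrite nth_default ?mul0r.
  rewrite exprMn -rmorphXn /= coefMC coefXn gtn_eqF ?mul0r ?mulr0 //.
  exact: leq_trans (ltn_ord j) hi.
rewrite coefMXn ltnNge; case: leqP => //= hle.
rewrite coef_swapXY coef_comp_poly_Xn //; case: ifP => //.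
by rewrite coef0.
Qed.

Lemma stretchXn p q n : (0 < q)%N -> stretch p q ('X^n : {poly {poly R}}) = 'X^(q * n).
Proof.
move=> q0; apply/polyP => e; apply/polyP => i; rewrite coef_stretch // !coefXn.
case: i => [|i]; rewrite ?muln0 ?subn0 /=.
  case: ifP => [/dvdnP [c ->]|hd].
    by rewrite mulnK // [(q * n)%N]mulnC eqn_pmul2r //; case: eqP.
  case: eqP => [e'|]; last by rewrite coef0.
  by move: hd; rewrite e' dvdn_mulr.
have z (b : bool) : (b%:R : {poly R})`_i.+1 = 0.
  by case: b; rewrite ?coef0 ?coef1.
by rewrite !z; case: ifP.
Qed.

Lemma stretchC p q (c : R) : (0 < q)%N -> stretch p q c%:P%:P = c%:P%:P.
Proof.
move=> q0; apply/polyP => e; apply/polyP => i; rewrite coef_stretch // !coefC.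
case: i => [|i]; rewrite ?muln0 ?subn0 /=.
  case: ifP => [/dvdnP [d ->]|hd].
    by rewrite mulnK // muln_eq0 (gtn_eqF q0) orbF; case: eqP => // _; rewrite coefC.
  by case: eqP => [e'|]; rewrite ?coef0 //; move: hd; rewrite e' dvdn0.
have z (b : bool) : (if b then c%:P else 0)`_i.+1 = 0.
  by case: b; rewrite ?coef0 ?coefC.
by rewrite !z; case: ifP.
Qed.

Lemma inner_deriv_stretch p q f : (0 < q)%N ->
  inner_deriv (stretch p q f) = 'X^p * stretch p q (inner_deriv f).
Proof.
move=> q0; apply/polyP => e; apply/polyP => i.
rewrite coef_inner_deriv coef_deriv coefXnM coef_stretch //.
case: (ltnP e p) => hep.
  by rewrite coef0 leqNgt (leq_trans hep) ?leq_pmulr // mul0rn.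
rewrite coef_stretch //.
have -> : (p * i.+1 <= e)%N = (p * i <= e - p)%N by rewrite mulnS; lia.
have -> : (e - p * i.+1 = e - p - p * i)%N by rewrite mulnS; lia.
by case: ifP => _; rewrite ?mul0rn // coef_inner_deriv coef_deriv.
Qed.

Lemma euler_stretch p q N f : (0 < q)%N ->
  euler (q * N) (stretch p q f) =
    stretch p q (euler N f) *+ q + 'X%:P * inner_deriv (stretch p q f) *+ p.
Proof.
move=> q0; apply/polyP => e; apply/polyP => i.
have mX (h : {poly {poly R}}) j l : ('X * h^`())`_j`_l = h`_j`_l *+ j.
  rewrite coefXM; case: j => [|j] /=; first by rewrite coef0 mulr0n.
  by rewrite coef_deriv coefMn.
rewrite {1}/euler !(coefB, coefD, coefMn) mX coefCM coefXM coef_inner_deriv.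
rewrite [(if i == 0%N then _ else _)](_ : _ = (stretch p q f)`_e`_i *+ i); last first.
  by case: i => [|i] /=; rewrite ?mulr0n // coef_deriv.
rewrite 2!(coef_stretch p _ _ _ q0).
case: ifP => [/andP [hle /dvdnP [c hc]]|_]; last by rewrite !mul0rn subr0 addr0.
rewrite hc mulnK // /euler !(coefB, coefMn) mX.
have -> : e = (c * q + p * i)%N by rewrite -hc subnK.
ring.
Qed.

(** The two terms [p * x * d/dx] produced by the chain rule cancel. *)
Lemma jac_stretch p q N M f g : (0 < q)%N ->
  jac (q * N) (q * M) (stretch p q f) (stretch p q g) =
    'X^p * stretch p q (jac N M f g) *+ q.
Proof.
move=> q0; rewrite /jac 2!(euler_stretch p _ _ q0) 2!(inner_deriv_stretch p _ q0).
rewrite (stretchB p q (inner_deriv f * euler M g)) 2!stretchM.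
ring.
Qed.

End Bivariate.

(** Since [E > 0] the bracket of the leading forms vanishes. *)
Lemma jac_top (K : numClosedFieldType) a b k E (J : K)
    (f g : {poly {poly K}}) : (0 < k)%N -> (0 < E)%N ->
  jac (a * k) (b * k) f g = J%:P%:P * 'X^E ->
  f`_0 * (g`_0)^`() *+ a = (f`_0)^`() * g`_0 *+ b.
Proof.
move=> k0 E0 /(congr1 (fun h : {poly {poly K}} => h`_0)).
rewrite coefMXn E0 /jac /euler coefB !coef0M !coefB !coef0M coefX !mul0r.
rewrite !coefMn !coef_inner_deriv !sub0r => h.
have {}h : (f`_0 * (g`_0)^`() *+ a) *+ k = ((f`_0)^`() * g`_0 *+ b) *+ k.
  by apply/eqP; rewrite -subr_eq0; apply/eqP; rewrite -[RHS]h; ring.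
by move: h; rewrite -!(scaler_nat k) => /(scalerI (natr_neq0 K k0)).
Qed.

(** * Edges of Newton polygons *)

Lemma Xn_factor (R : nzRingType) (h : {poly R}) n :
  (forall i, (i < n)%N -> h`_i = 0) -> h = drop_poly n h * 'X^n.
Proof.
move=> h0; apply/polyP => i; rewrite coefMXn coef_drop_poly.
by case: ltnP => [/h0 //|ni]; rewrite subnK.
Qed.

Lemma Xn_part (R : nzRingType) (h : {poly R}) : h != 0 ->
  exists e h', h = h' * 'X^e /\ h'`_0 != 0.
Proof.
move=> h0.
have ex : exists i, h`_i != 0.
  by exists (size h).-1; rewrite -lead_coefE lead_coef_eq0.
exists (ex_minn ex), (drop_poly (ex_minn ex) h).
case: ex_minnP => e he min; split; last by rewrite coef_drop_poly.
apply: Xn_factor => i; rewrite ltnNge => /negP ie.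
by apply/eqP/negPn/negP => /min.
Qed.

Lemma Xn_dvd_root (R : idomainType) (h r : {poly R}) a e : (0 < a)%N ->
  h ^+ a = r * 'X^(a * e) -> exists h', h = h' * 'X^e.
Proof.
move=> a0; have [->|h0] := eqVneq h 0; first by exists 0; rewrite mul0r.
have [v [h1 [-> h10]]] := Xn_part h0 => eq.
have ev : (e <= v)%N.
  rewrite leqNgt; apply/negP => ve.
  move: eq => /(congr1 (fun p : {poly R} => p`_(v * a))).
  rewrite exprMn -exprM !coefMXn ltnn subnn mulnC ltn_pmul2l // ve.
  by rewrite -!horner_coef0 horner_exp horner_coef0; apply/eqP; rewrite expf_neq0.
by exists (h1 * 'X^(v - e)); rewrite -mulrA -exprD subnK.
Qed.

(** Minimizing [j / d] amounts to minimizing the integer [j * (D! / d)]. *)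
Lemma min_slope (S : nat -> nat -> bool) D :
  (forall d j, S d j -> (0 < d <= D)%N) -> (exists d j, S d j) ->
  exists d j, S d j /\ (forall d' j', S d' j' -> (j * d' <= j' * d)%N).
Proof.
move=> hD [d [j Sdj]].
pose scaled d j := (j * (D`! %/ d))%N.
pose P v := [exists d : 'I_D.+1, [exists j : 'I_v.+1, S d j && (scaled d j == v)]].
have inP d1 j1 : S d1 j1 -> P (scaled d1 j1).
  move=> s; have /andP [d10 d1D] := hD _ _ s.
  have d1D' : (d1 < D.+1)%N by [].
  have hj : (j1 < (scaled d1 j1).+1)%N.
    rewrite ltnS /scaled leq_pmulr // divn_gt0 //.
    by apply: dvdn_leq; rewrite ?fact_gt0 // dvdn_fact // d10.
  apply/existsP; exists (Ordinal d1D'); apply/existsP; exists (Ordinal hj).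
  by rewrite s /=.
case: (ex_minnP (ex_intro (fun v => P v) _ (inP _ _ Sdj))) => v.
move=> /existsP [d0 /existsP [j0]].
move=> /andP [s0 /eqP e0] min.
exists d0, j0; split=> // d' j' s'.
have /andP [d0p d0D] := hD _ _ s0; have /andP [d'p d'D] := hD _ _ s'.
have {min}: (scaled d0 j0 <= scaled d' j')%N by rewrite e0; apply: min; apply: inP.
rewrite /scaled.
have /dvdnP [u uE] : (d0 %| D`!)%N by rewrite dvdn_fact // d0p.
have /dvdnP [w wE] : (d' %| D`!)%N by rewrite dvdn_fact // d'p.
rewrite {1}uE wE !mulnK // => h.
have D0 := fact_gt0 D.
rewrite -(@leq_pmul2r D`!) // {1}uE wE.
have -> : (j0 * d' * (u * d0) = j0 * u * (d0 * d'))%N by ring.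
have -> : (j' * d0 * (w * d') = j' * w * (d0 * d'))%N by ring.
by rewrite leq_mul2r h orbT.
Qed.

Section Face.
Variable K : numClosedFieldType.
Implicit Types (h : {poly {poly K}}).

(** If no point of the support of [h] lies below the edge
    [p * i + q * j = p * M], then [h'] at [t = 0] is the edge polynomial of [h]. *)
Lemma stretch_face p q M h : (0 < p)%N -> (0 < q)%N ->
  (forall i j, (i < M)%N -> h`_j`_i != 0 -> (p * (M - i) <= q * j)%N) ->
  exists h', [/\ stretch p q h = h' * 'X^(p * M),
    forall i, (M < i)%N -> h'`_0`_i = 0,
    forall i j, (i <= M)%N -> (q * j = p * (M - i))%N -> h'`_0`_i = h`_j`_i &
    forall i, (i <= M)%N -> h'`_0`_i != 0 -> (q %| p * (M - i))%N].
Proof.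
move=> p0 q0 hM; exists (drop_poly (p * M) (stretch p q h)).
have c0 i : (drop_poly (p * M) (stretch p q h))`_0`_i =
    (stretch p q h)`_(p * M)`_i by rewrite coef_drop_poly.
split.
- apply: Xn_factor => e he; apply/polyP => i; rewrite coef0 (coef_stretch p _ _ _ q0).
  case: ifP => // /andP [hie /dvdnP [j hj]]; rewrite hj mulnK //.
  apply/eqP/negPn/negP => nz.
  have [iM|Mi] := ltnP i M; last first.
    have : (p * M <= p * i)%N by rewrite leq_mul2l Mi orbT.
    by lia.
  have := hM _ _ iM nz; rewrite mulnBr mulnC [(q * j)%N]mulnC -hj.
  by move: he hie; rewrite ![(p * _)%N]mulnC; lia.
- move=> i Mi; rewrite c0 (coef_stretch p _ _ _ q0) leq_pmul2l //.
  by rewrite leqNgt Mi.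
- move=> i j iM e; rewrite c0 (coef_stretch p _ _ _ q0) leq_pmul2l // iM.
  by rewrite -mulnBr -e /= dvdn_mulr // mulKn.
- move=> i iM; rewrite c0 (coef_stretch p _ _ _ q0) mulnBr.
  by case: ifP; rewrite ?eqxx // => /andP [].
Qed.

(** Without knowledge of the lower edge of [h]: the order [e] in [t] is at most the
    weight of the point [(i, 0)], and this also bounds the degree of the edge
    polynomial. *)
Lemma stretch_neq0 p q h i : (0 < q)%N -> h`_0`_i != 0 ->
  exists e h', [/\ stretch p q h = h' * 'X^e, (e <= p * i)%N, h'`_0 != 0 &
    forall j, h'`_0`_j != 0 -> (p * j <= e)%N].
Proof.
move=> q0 hi.
have ci : (stretch p q h)`_(p * i)`_i = h`_0`_i.
  by rewrite (coef_stretch p _ _ _ q0) leqnn subnn dvdn0 div0n.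
have nz : stretch p q h != 0.
  by apply: contraNneq hi => h0; rewrite -ci h0 !coef0.
have [e [h' [hE h'0]]] := Xn_part nz; exists e, h'; split=> //.
  rewrite leqNgt; apply/negP => lt.
  by move: hi; rewrite -ci hE coefMXn lt coef0 eqxx.
move=> j; have -> : h'`_0`_j = (stretch p q h)`_e`_j by rewrite hE coefMXn ltnn subnn.
by rewrite (coef_stretch p _ _ _ q0); case: ifP; rewrite ?eqxx // => /andP [].
Qed.

End Face.

(** * Divisors on the path of blow-ups *)

Section Descent.
Variable K : numClosedFieldType.
Variables a b : nat.
Hypotheses (a0 : (0 < a)%N) (b0 : (0 < b)%N) (cab : coprime a b).
Implicit Types (f g q z : {poly {poly K}}).

(** The data carried along the path of blow-ups: at [t = 0] one has a divisor along
    which [F = t^(-ak) f], [G = t^(-bk) g], [Q = t^(-k) q] and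
    [zeta = t^(d-ak) z]. The bracket of [F] and [G] is constant for the original
    coordinates, which yields the power [E] of [t]; [L] is the degree of the leading
    form of [Q]. *)
Record node k E d L f g q z : Prop := Node {
  node_k : (0 < k)%N;
  node_E : (0 < E)%N;
  node_f : f = q ^+ a + 'X^d * z;
  node_jac : exists J : K, jac (a * k) (b * k) f g = J%:P%:P * 'X^E;
  node_g0 : g`_0 != 0;
  node_z0 : z`_0 != 0;
  node_size : size f`_0 = (a * L).+1;
  node_slack : slack a b k E d L (size z`_0).-1 }.

Lemma coef0_exp (h : {poly {poly K}}) n : (h ^+ n)`_0 = h`_0 ^+ n.
Proof. by rewrite -!horner_coef0 horner_exp. Qed.

Lemma node_f0 k E d L f g q z : node k E d L f g q z -> f`_0 != 0.
Proof. by move=> N; rewrite -size_poly_gt0 (node_size N). Qed.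

Lemma node_relation k E d L f g q z : node k E d L f g q z ->
  exists2 c : K, c != 0 & g`_0 ^+ a = c *: f`_0 ^+ b.
Proof.
move=> N; have [J hJ] := node_jac N.
apply: power_relation (node_f0 N) (node_g0 N) _ => //.
exact: jac_top (node_k N) (node_E N) hJ.
Qed.

(** The moment [d = 0] at which [zeta] catches up with [F] is excluded: as the
    leading forms of [F] and [G] commute and [a], [b] are coprime, [f] at [t = 0]
    is an [a]-th power, whereas it differs from [q ^+ a] by a nonzero polynomial
    of too small degree. *)
Lemma node_d_gt0 k E d L f g q z : node k E d L f g q z -> (0 < d)%N.
Proof.
move=> N; rewrite lt0n; apply/eqP => d0; have f0 := node_f0 N.
have [c c0 gf] := node_relation N.
have [R RE] := power_of_coprime_relation a0 cab f0 (node_g0 N) c0 gf.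
have R0 : R != 0 by apply: contraNneq f0 => R0; rewrite RE R0 expr0n gtn_eqF.
have sR : size R = L.+1.
  have := size_exp R a; rewrite -RE (node_size N) /= mulnC => /eqP.
  rewrite eqn_pmul2r // => /eqP ->; by rewrite prednK // size_poly_gt0.
have [s1 _ _] := node_slack N.
apply: (@close_powers K a L R q`_0 z`_0) => //.
- by case: L s1 {N sR} => //; rewrite muln0.
- exact: node_z0 N.
- by move: s1; case: (size z`_0).
- by rewrite -RE {1}(node_f N) d0 mul1r coefD coef0_exp.
Qed.

Lemma node_q0 k E d L f g q z : node k E d L f g q z ->
  f`_0 = q`_0 ^+ a /\ size q`_0 = L.+1.
Proof.
move=> N; have e : f`_0 = q`_0 ^+ a.
  by rewrite {1}(node_f N) coefD coefXnM (node_d_gt0 N) addr0 coef0_exp.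
split=> //; have q0 : q`_0 != 0.
  by have := node_f0 N; rewrite e; apply: contraNneq => ->; rewrite expr0n gtn_eqF.
have := size_exp q`_0 a; rewrite -e (node_size N) /= mulnC => /eqP.
by rewrite eqn_pmul2r // => /eqP ->; rewrite prednK // size_poly_gt0.
Qed.

Lemma coef_XsubC_exp_pred (x : K) n : (0 < n)%N ->
  (('X - x%:P) ^+ n)`_n.-1 = - x *+ n.
Proof.
case: n => // n _; elim: n => [|n IH].
  by rewrite expr1 coefB coefX coefC sub0r.
rewrite exprSr mulrBr coefB coefMX coefMC /= IH.
have -> : (('X - x%:P) ^+ n.+1)`_n.+1 = 1.
  have m : ('X - x%:P) ^+ n.+1 \is monic by rewrite monic_exp // monicXsubC.
  by rewrite -(monicP m) lead_coefE size_exp_XsubC.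
by rewrite mul1r -mulrSr.
Qed.

(** A root of the leading form of [q] that inherits the slack is moved to [x = 0]. *)
Lemma node_centered k E d L f g q z : node k E d L f g q z ->
  exists x l p (F G Q Z : {poly {poly K}}),
   [/\ l = mup x q`_0, (0 < l)%N, slack a b k E d l p,
       F = Q ^+ a + 'X^d * Z &
       exists J : K, jac (a * k) (b * k) F G = J%:P%:P * 'X^E] /\
   [/\ forall i, (i < a * l)%N -> F`_0`_i = 0, F`_0`_(a * l) != 0,
       forall i, (i < b * l)%N -> G`_0`_i = 0, G`_0`_(b * l) != 0 &
       Z`_0`_p != 0].
Proof.
move=> N; have f0 := node_f0 N; have g0 := node_g0 N; have z0 := node_z0 N.
have [fq sq] := node_q0 N.
have q0 : q`_0 != 0 by rewrite -size_poly_gt0 sq.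
have [x sl] : exists x, slack a b k E d (mup x q`_0) (mup x z`_0).
  apply: root_with_slack => //; [exact: node_k N | exact: node_E N |].
  by rewrite sq; apply: node_slack N.
have mf : mup x f`_0 = (a * mup x q`_0)%N by rewrite fq mupX.
have mg : mup x g`_0 = (b * mup x q`_0)%N.
  have [c c0 gf] := node_relation N.
  have : mup x (g`_0 ^+ a) = mup x (f`_0 ^+ b).
    by rewrite gf -mul_polyC mupMr // rootC.
  rewrite !mupX // mf mulnCA => /eqP; rewrite eqn_pmul2l // => /eqP //.
exists x, (mup x q`_0), (mup x z`_0), (shiftx x f), (shiftx x g),
  (shiftx x q), (shiftx x z).
have [F1 F2] := coef_shift_mup x f0; have [G1 G2] := coef_shift_mup x g0.
have [_ Z2] := coef_shift_mup x z0.
rewrite !coef_shiftx -mf -mg; split; split=> //.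
- by case: sl; case: (mup x q`_0); rewrite ?muln0.
- by rewrite {1}(node_f N) rmorphD rmorphM rmorphXn /= shiftxXn.
- have [J hJ] := node_jac N; exists J.
  by rewrite jac_shiftx hJ rmorphM /= shiftxC shiftxXn.
Qed.

End Descent.

(** * The descent *)

(** Moving along a ray of slope [p / q] lowers the gap [d] at a rate at least [c],
    and [d * M < c * E] says that [E], which falls at the rate [M], outlives the
    gap. *)
Lemma slope_transfer (p q d d' c M E : nat) : (0 < q)%N -> (0 < c)%N ->
  (d' + p * c <= q * d)%N -> (d * M < c * E)%N ->
  (p * M < q * E)%N /\ (d' * M < c * (q * E - p * M))%N.
Proof.
move=> q0 c0 h1 h2.
have key : (d' * M + c * (p * M) < c * (q * E))%N.
  apply: (@leq_ltn_trans (q * (d * M))%N).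
    have -> : (d' * M + c * (p * M) = (d' + p * c) * M)%N by ring.
    by rewrite mulnA leq_mul2r h1 orbT.
  have -> : (c * (q * E) = q * (c * E))%N by ring.
  by rewrite ltn_mul2l q0.
split; last by rewrite mulnBr; lia.
by rewrite -(@ltn_pmul2l c) //; lia.
Qed.

Lemma slack_transfer a b k E d d' l m m' p q e : (0 < a)%N -> (0 < q)%N ->
  (0 < l)%N -> slack a b k E d l m -> (d' + p * (a * l) = q * d + e)%N ->
  (e <= p * m)%N -> (m' <= m)%N ->
  exists k' E', [/\ (0 < k')%N, (0 < E')%N, (q * k = k' + p * l)%N,
    (q * E + p = E' + p * ((a + b) * l))%N & slack a b k' E' d' l m'].
Proof.
move=> a0 q0 l0 [s1 s2 s3] de em mm.
have mal : (m < a * l)%N by apply: leq_trans s1 _; rewrite leq_mul2r leq_pred orbT.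
pose c := (a * l - m)%N.
have c0 : (0 < c)%N by rewrite subn_gt0.
have ca : (a * l = m + c)%N by rewrite /c; lia.
have h1 : (d' + p * c <= q * d)%N.
  by move: de; rewrite ca mulnDr; lia.
have [M ME] : exists M, ((a + b) * l)%N = M.+1.
  by exists ((a + b) * l).-1; rewrite prednK // muln_gt0 l0 addn_gt0 a0.
have t2 : (d * l < c * k)%N by move: s2; rewrite ca mulnDl; lia.
have t3 : (d * M < c * E)%N by move: s3; rewrite ca ME mulnDl mulnS; lia.
have [k1 k2] := slope_transfer q0 c0 h1 t2.
have [E1 E2] := slope_transfer q0 c0 h1 t3.
exists (q * k - p * l)%N, (q * E - p * M)%N; split.
- by rewrite subn_gt0.
- by rewrite subn_gt0.
- by rewrite subnK // ltnW.
- by rewrite ME mulnS; lia.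
move: k2 E2; set k' := (q * k - p * l)%N; set E' := (q * E - p * M)%N => k2 E2.
split; first exact: leq_ltn_trans mm s1.
  rewrite ca mulnDl; have : (m' * k' <= m * k')%N by rewrite leq_mul2r mm orbT.
  by lia.
rewrite ca ME mulnDl mulnS; have : (m' * E' <= m * E')%N by rewrite leq_mul2r mm orbT.
by lia.
Qed.

Section Step.
Variable K : numClosedFieldType.
Variables a b : nat.
Hypotheses (a0 : (0 < a)%N) (b0 : (0 < b)%N) (cab : coprime a b).
Implicit Types (f g z : {poly {poly K}}).

(** One blow-up, along the first edge that appears when the slope increases from
    zero: an edge of [f], of [g], or the point where [zeta] catches up with [F].
    The last case is impossible, and an edge of [g] alone is incompatible with the
    commuting leading forms. Hence [f] has an edge; if its edge polynomial is a
    power of a single [x - y], then [y != 0], the coefficient next to the leading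
    one does not vanish, the slope is an integer, and [k] drops. *)
Lemma node_step k E d L f g (q : {poly {poly K}}) z :
  node a b k E d L f g q z ->
  exists l k' E' d' f' g' (q' : {poly {poly K}}) z',
   [/\ node a b k' E' d' l f' g' q' z', exists x, l = mup x q`_0 &
       forall y, mup y q'`_0 = l -> (k' < k)%N].
Proof.
move=> N; have d0 := node_d_gt0 a0 b0 cab N.
have [x [l [m [F [G [Q [Z]]]]]]] := node_centered a0 b0 cab N.
move=> [[lx l0 sl FE [J hJ]] [F0 Fl G0 Gl Zm]].
pose H : {poly {poly K}} := 'X^d * Z.
have mal : (m < a * l)%N.
  by case: sl => s _ _; apply: leq_trans s _; rewrite leq_mul2r leq_pred orbT.
have H0 : H`_0 = 0 by rewrite coefXnM d0.
(* Pairs [(u, j)] such that a support point [u] steps to the left of the vertex, at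
   height [j], forces the slope to be at most [j / u]. *)
pose S u j := (0 < u)%N &&
  [|| (u <= a * l)%N && (F`_j`_(a * l - u) != 0),
      (u <= b * l)%N && (G`_j`_(b * l - u) != 0) |
      (u <= a * l)%N && (H`_j`_(a * l - u) != 0)].
have [u [j [/andP [u0 tight] minS]]] : exists u j, S u j /\
    (forall u' j', S u' j' -> (j * u' <= j' * u)%N).
  apply: (@min_slope S (a * l + b * l)) => [u j|].
    case/andP=> -> /or3P [] /andP [hu _] /=; lia.
  exists (a * l - m)%N, d; rewrite /S subn_gt0 mal leq_subr subKn ?(ltnW mal) //=.
  by rewrite /H coefXnM ltnn subnn Zm !orbT.
have j0 : (0 < j)%N.
  rewrite lt0n; apply/negP => /eqP j0; move: tight; rewrite j0.
  case/or3P=> /andP [hu]; rewrite ?H0 ?coef0 ?eqxx // ?F0 ?G0 ?eqxx //; lia.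
pose w := gcdn j u.
have w0 : (0 < w)%N by rewrite gcdn_gt0 j0.
pose p := (j %/ w)%N; pose s := (u %/ w)%N.
have jE : j = (p * w)%N by rewrite divnK // dvdn_gcdl.
have uE : u = (s * w)%N by rewrite divnK // dvdn_gcdr.
have p0 : (0 < p)%N by move: j0; rewrite jE muln_gt0 => /andP [].
have s0 : (0 < s)%N by move: u0; rewrite uE muln_gt0 => /andP [].
have cps : coprime p s.
  by rewrite /coprime -(@eqn_pmul2r w) // muln_gcdl -jE -uE mul1n.
have {}minS u' j' : S u' j' -> (p * u' <= s * j')%N.
  move=> /minS h; rewrite -(leq_pmul2r w0).
  have -> : (p * u' * w = j * u')%N by rewrite jE; ring.
  by have -> : (s * j' * w = j' * u)%N by rewrite uE; ring.
have su : (s * j = p * u)%N by rewrite jE uE; ring.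
have face M (h : {poly {poly K}}) :
    (forall v i, (0 < v)%N -> (v <= M)%N -> h`_i`_(M - v) != 0 -> S v i) ->
    forall i c, (i < M)%N -> h`_c`_i != 0 -> (p * (M - i) <= s * c)%N.
  move=> hS i c iM nz; apply: minS; apply: hS; rewrite ?subn_gt0 ?leq_subr //.
  by rewrite subKn // ltnW.
have [f' [f'E f'1 f'2 f'3]] := @stretch_face K p s (a * l) F p0 s0
  (face (a * l)%N F (fun v i v0 vl nz => ltac:(by rewrite /S v0 vl nz))).
have [g' [g'E g'1 g'2 g'3]] := @stretch_face K p s (b * l) G p0 s0
  (face (b * l)%N G (fun v i v0 vl nz => ltac:(by rewrite /S v0 vl nz orbT))).
have [h' [h'E h'1 h'2 h'3]] := @stretch_face K p s (a * l) H p0 s0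
  (face (a * l)%N H (fun v i v0 vl nz => ltac:(by rewrite /S v0 vl nz !orbT))).
have [e [z' [z'E em z'0 z'sz]]] := stretch_neq0 p s0 Zm.
have HE : h' * 'X^(p * (a * l)) = z' * 'X^(s * d + e).
  by rewrite -h'E stretchM (stretchXn _ p _ s0) z'E exprD; ring.
have led : (p * (a * l) <= s * d + e)%N.
  rewrite leqNgt; apply/negP => lt.
  move: HE => /(congr1 (fun r : {poly {poly K}} => r`_(s * d + e))).
  by rewrite !coefMXn ltnn subnn lt => h; rewrite -h eqxx in z'0.
pose d' := (s * d + e - p * (a * l))%N.
have dE : (d' + p * (a * l) = s * d + e)%N by rewrite subnK.
have h'd : h' = 'X^d' * z'.
  apply: (mulIf (x := 'X^(p * (a * l)))); first by rewrite -size_poly_gt0 size_polyXn.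
  by rewrite HE -dE exprD; ring.
have sF : stretch p s F = stretch p s Q ^+ a + stretch p s H.
  rewrite FE; have -> : Q ^+ a + 'X^d * Z = Q ^+ a - (0 - H) by rewrite sub0r opprK.
  have sX n : stretch p s (Q ^+ n) = stretch p s Q ^+ n.
    elim: n => [|n IH]; last by rewrite !exprS stretchM IH.
    by rewrite !expr0 -(expr0 'X) stretchXn // muln0.
  have s00 : stretch p s (0 : {poly {poly K}}) = 0.
    by rewrite -[X in stretch _ _ X](subrr 0) stretchB subrr.
  by rewrite !stretchB s00 sub0r opprK sX.
have [q' q'E] : exists q', stretch p s Q = q' * 'X^(p * l).
  apply: (@Xn_dvd_root _ _ (f' - h') a _ a0).
  have -> : (a * (p * l) = p * (a * l))%N by ring.
  by rewrite mulrBl -f'E -h'E sF addrK.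
have nX (M : nat) : ('X^M : {poly {poly K}}) != 0.
  by rewrite -size_poly_gt0 size_polyXn.
have f'qz : f' = q' ^+ a + 'X^d' * z'.
  apply: (mulIf (nX (p * (a * l))%N)).
  rewrite -f'E sF q'E exprMn -exprM mulrDl -h'd h'E; congr (_ * 'X^_ + _); ring.
have f'l : f'`_0`_(a * l) != 0.
  by rewrite (f'2 _ 0%N) // subnn !muln0.
have g'l : g'`_0`_(b * l) != 0.
  by rewrite (g'2 _ 0%N) // subnn !muln0.
have mm : ((size (z'`_0)%R).-1 <= m)%N.
  have lz : z'`_0`_(size z'`_0).-1 != 0 by rewrite -lead_coefE lead_coef_eq0.
  by rewrite -(leq_pmul2l p0); apply: leq_trans em; apply: z'sz.
have [k' [E' [k'0 E'0 kE EE sl']]] := slack_transfer a0 s0 l0 sl dE em mm.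
have N' : node a b k' E' d' l f' g' q' z'.
  split=> //.
  - exists (J *+ s); apply: (mulIf (nX (p * (a * l) + p * (b * l))%N)).
    have := jac_stretch p (a * k) (b * k) F G s0.
    rewrite hJ stretchM (stretchC p _ s0) (stretchXn _ p _ s0) f'E g'E.
    have -> : (s * (a * k) = a * k' + p * (a * l))%N.
      by rewrite mulnCA kE; ring.
    have -> : (s * (b * k) = b * k' + p * (b * l))%N.
      by rewrite mulnCA kE; ring.
    rewrite jac_mulXn mulrC => ->.
    have -> : 'X^p * (J%:P%:P * 'X^(s * E)) = J%:P%:P * 'X^(s * E + p) :> {poly {poly K}}.
      by rewrite exprD; ring.
    rewrite EE -mulnDr -mulnDl [(E' + _)%N]addnC exprD !polyCMn; ring.
  - by apply: contraNneq g'l => ->; rewrite coef0.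
  - apply/eqP; rewrite eqn_leq; apply/andP; split; last first.
      by rewrite ltnNge; apply/negP => /leq_sizeP /(_ _ (leqnn _)) /eqP; apply/negP.
    by apply/leq_sizeP => i /f'1.
exists l, k', E', d', f', g', q', z'; split=> //; first by exists x.
(* What remains is the decrease of [k] when a single root survives. *)
move=> y yl.
have d'0 := node_d_gt0 a0 b0 cab N'.
have [f'q sq'] := node_q0 a0 b0 cab N'.
have q'0 : q'`_0 != 0 by rewrite -size_poly_gt0 sq'.
have [c c0 q'c] : exists2 c : K, c != 0 & q'`_0 = c *: ('X - y%:P) ^+ l.
  by rewrite -yl; apply: mup_full_power => //; rewrite yl sq'.
have f'c : f'`_0 = c ^+ a *: ('X - y%:P) ^+ (a * l).
  by rewrite f'q q'c exprZn -exprM [(l * a)%N]mulnC.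
have y0 : y != 0.
  apply/negP => /eqP y0; rewrite y0 polyC0 subr0 in f'c.
  case/or3P: tight => /andP [hu].
  - rewrite -(f'2 _ j) ?leq_subr //; last by rewrite subKn.
    have lt : (a * l - u < a * l)%N by clear -u0 hu; lia.
    by rewrite f'c coefZ coefXn (ltn_eqF lt) mulr0 eqxx.
  - rewrite -(g'2 _ j) ?leq_subr //; last by rewrite subKn.
    have [c' c'0 g'c] := node_relation a0 b0 N'.
    have [r rE] : exists r, g'`_0 = r * 'X^(b * l).
      apply: (@Xn_dvd_root _ _ (c' * (c ^+ a) ^+ b)%:P a _ a0).
      have XE : ('X^(a * l)) ^+ b = 'X^(a * (b * l)) :> {poly K}.
        by rewrite -exprM; congr 'X^_; ring.
      by rewrite g'c f'c exprZn XE scalerA mul_polyC.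
    have lt : (b * l - u < b * l)%N by clear -u0 hu; lia.
    by rewrite rE coefMXn lt eqxx.
  - rewrite -(h'2 _ j) ?leq_subr //; last by rewrite subKn.
    by rewrite h'd coefXnM d'0 coef0 eqxx.
have al0 : (0 < a * l)%N by rewrite muln_gt0 a0.
have : (s %| p * (a * l - (a * l).-1))%N.
  apply: f'3; first exact: leq_pred.
  rewrite f'c coefZ coef_XsubC_exp_pred // -mulr_natr !mulf_neq0 ?oppr_eq0 //.
    by rewrite expf_neq0.
  exact: natr_neq0.
have -> : (a * l - (a * l).-1 = 1)%N by rewrite -{1}(prednK al0) subSnn.
rewrite muln1 => sp; have s1 : s = 1%N.
  by have /eqP := cps; rewrite gcdnC => <-; apply/esym/gcdn_idPl.
by move: kE; rewrite s1 mul1n => ->; rewrite -addn1 leq_add2l muln_gt0 p0.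
Qed.

Lemma mup_lt_size (y : K) (r : {poly K}) : r != 0 -> (mup y r < size r)%N.
Proof.
move=> r0; have : ('X - y%:P) ^+ mup y r %| r by rewrite -mup_geq.
by move=> /(dvdp_leq r0); rewrite size_exp_XsubC.
Qed.

(** Descent on the largest multiplicity [n] of a root of the leading form of [q],
    then on [k]: a step that does not lower [n] leaves a single root of
    multiplicity [n]. *)
Lemma no_node k E d L f g (q : {poly {poly K}}) z : ~ node a b k E d L f g q z.
Proof.
suff main n : forall k E d L f g (q : {poly {poly K}}) z,
    node a b k E d L f g q z -> (forall x, mup x (q`_0)%R <= n)%N -> False.
  move=> N; apply: (main L _ _ _ _ _ _ _ _ N) => x.
  have [_ sq] := node_q0 a0 b0 cab N.
  have q0 : q`_0 != 0 by rewrite -size_poly_gt0 sq.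
  by have := mup_lt_size x q0; rewrite sq.
elim/ltn_ind: n => n IHn {}k; elim/ltn_ind: k => k IHk {}E {}d {}L {}f {}g {}q {}z N mn.
have [l [k' [E' [d' [f' [g' [q' [z' [N' [x lx] kk]]]]]]]]] := node_step N.
have [_ sq'] := node_q0 a0 b0 cab N'.
have q'0 : q'`_0 != 0 by rewrite -size_poly_gt0 sq'.
have ml y : (mup y (q'`_0)%R <= l)%N by have := mup_lt_size y q'0; rewrite sq'.
have ln : (l <= n)%N by rewrite lx.
have [[y yl]|no] := pselect (exists y, mup y q'`_0 = l).
  by apply: (IHk k' (kk y yl) _ _ _ _ _ _ _ N') => w; apply: leq_trans (ml w) ln.
have lt y : (mup y (q'`_0)%R < l)%N.
  by rewrite ltn_neqAle ml andbT; apply/eqP => e; apply: no; exists y.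
have l0 : (0 < l)%N by apply: leq_ltn_trans (lt 0).
apply: (IHn l.-1 _ _ _ _ _ _ _ _ _ N') => [|y]; first by rewrite prednK.
by rewrite -ltnS prednK.
Qed.

End Step.

(** * Starting at the line at infinity *)

Section Reversal.
Variable R : comNzRingType.
Implicit Types (g h : {poly {poly R}}).

(** The polynomial [x ^ n * h (1 / x)]. *)
Definition rev_poly n h : {poly {poly R}} := \poly_(j < n.+1) h`_(n - j).

Lemma coef_rev n h j : (rev_poly n h)`_j = if (j <= n)%N then h`_(n - j) else 0.
Proof. by rewrite coef_poly ltnS. Qed.

Lemma rev_polyB n g h : rev_poly n (g - h) = rev_poly n g - rev_poly n h.
Proof.
by apply/polyP => j; rewrite coefB !coef_rev; case: ifP; rewrite ?coefB ?subr0.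
Qed.

Lemma rev_polyD n g h : rev_poly n (g + h) = rev_poly n g + rev_poly n h.
Proof.
by apply/polyP => j; rewrite coefD !coef_rev; case: ifP; rewrite ?coefD ?addr0.
Qed.

Lemma rev_poly_monomial n i (c : {poly R}) : (i <= n)%N ->
  rev_poly n (c *: 'X^i) = c *: 'X^(n - i).
Proof.
move=> iN; apply/polyP => j; rewrite coef_rev !coefZ !coefXn.
case: leqP => jn; first by congr (_ * _%:R); congr nat_of_bool; apply/eqP/eqP; lia.
by rewrite gtn_eqF ?mulr0 //; lia.
Qed.

Lemma rev_poly_sum n (I : Type) (r : seq I) (F : I -> {poly {poly R}}) :
  rev_poly n (\sum_(i <- r) F i) = \sum_(i <- r) rev_poly n (F i).
Proof.
elim: r => [|i r IH]; last by rewrite !big_cons rev_polyD IH.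
rewrite !big_nil; apply/polyP => j.
by rewrite coef_rev !coef0; case: ifP; rewrite ?coef0.
Qed.

Lemma rev_polyM n m g h : (size g <= n.+1)%N -> (size h <= m.+1)%N ->
  rev_poly (n + m) (g * h) = rev_poly n g * rev_poly m h.
Proof.
move=> sg sh.
have E (p : {poly {poly R}}) l : (size p <= l.+1)%N -> p = \sum_(i < l.+1) p`_i *: 'X^i.
  move=> sp; rewrite -poly_def; apply/polyP => i; rewrite coef_poly.
  by case: ltnP => // hi; rewrite nth_default // (leq_trans sp).
rewrite [in LHS](E g n sg) [in LHS](E h m sh) [in RHS](E g n sg) [in RHS](E h m sh).
rewrite mulr_suml !rev_poly_sum mulr_suml; apply: eq_bigr => i _.
rewrite mulr_sumr rev_poly_sum mulr_sumr; apply: eq_bigr => j _.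
have im : (i <= n)%N by rewrite -ltnS.
have jm : (j <= m)%N by rewrite -ltnS.
rewrite -scalerAl -scalerAr scalerA -exprD rev_poly_monomial ?leq_add //.
rewrite !rev_poly_monomial // -scalerAl -scalerAr scalerA -exprD.
by congr (_ *: 'X^_); lia.
Qed.

Lemma size_exp_le (p : {poly {poly R}}) k a : (size p <= k.+1)%N ->
  (size (p ^+ a)%R <= (a * k).+1)%N.
Proof.
move=> sp; elim: a => [|a IH]; first by rewrite expr0 size_poly1.
rewrite exprS; apply: leq_trans (size_polyMleq _ _) _.
by rewrite mulSn; move: (size p) (size (p ^+ a)) sp IH => u v; lia.
Qed.

Lemma rev_polyX k a h : (size h <= k.+1)%N ->
  rev_poly (a * k) (h ^+ a) = rev_poly k h ^+ a.
Proof.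
move=> sh; elim: a => [|a IH].
  rewrite mul0n !expr0; apply/polyP => j; rewrite coef_rev !coef1.
  by case: j.
by rewrite !exprS mulSn rev_polyM ?IH // size_exp_le.
Qed.

Lemma inner_deriv_rev n h : inner_deriv (rev_poly n h) = rev_poly n (inner_deriv h).
Proof.
apply/polyP => j; rewrite coef_inner_deriv !coef_rev coef_inner_deriv.
by case: ifP => // _; rewrite deriv0.
Qed.

Lemma euler_rev n h : euler n (rev_poly n h) = - rev_poly n ('X * h^`()).
Proof.
apply/polyP => j; rewrite /euler coefB coefMn coefN.
have mX (p : {poly {poly R}}) i : ('X * p^`())`_i = p`_i *+ i.
  by rewrite coefXM; case: i => [|i] /=; rewrite ?mulr0n // coef_deriv.
rewrite mX !coef_rev; case: leqP => jn; last by rewrite !mul0rn subr0 oppr0.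
by rewrite mX mulrnBr // opprB.
Qed.

Lemma size_inner_deriv h : (size (inner_deriv h) <= size h)%N.
Proof.
by apply/leq_sizeP => j hj; rewrite coef_inner_deriv nth_default ?deriv0.
Qed.

Lemma size_Xderiv h : (size ('X * h^`())%R <= size h)%N.
Proof.
apply/leq_sizeP => j hj; rewrite coefXM; case: j hj => // j hj.
by rewrite coef_deriv nth_default ?mul0rn.
Qed.

(** In the coordinate [t = 1 / x] the Euler operator of [x] becomes, up to sign,
    [t * d/dt - n]. *)
Lemma jac_rev N M (J : R) g h : (size g <= N.+1)%N -> (size h <= M.+1)%N ->
  (0 < N + M)%N -> g^`() * inner_deriv h - inner_deriv g * h^`() = J%:P%:P ->
  jac N M (rev_poly N g) (rev_poly M h) = J%:P%:P * 'X^((N + M).-1).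
Proof.
move=> sg sh NM e.
have -> : J%:P%:P * 'X^((N + M).-1) = rev_poly (N + M) (J%:P *: 'X^1).
  by rewrite rev_poly_monomial // subn1 -mul_polyC.
have -> : J%:P *: 'X^1 = 'X * g^`() * inner_deriv h - inner_deriv g * ('X * h^`()).
  by rewrite expr1 -mul_polyC -e; ring.
have sdg := leq_trans (size_inner_deriv g) sg.
have sdh := leq_trans (size_inner_deriv h) sh.
have sxg := leq_trans (size_Xderiv g) sg; have sxh := leq_trans (size_Xderiv h) sh.
rewrite rev_polyB (rev_polyM sxg sdh) (rev_polyM sdg sxh) /jac.
rewrite !euler_rev !inner_deriv_rev; ring.
Qed.

End Reversal.

(** The path of blow-ups starts at the divisor where the outer variable has its
    pole; there the volume form has a simple pole in the normalization of [jac],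
    whence [E = (a + b) * k - 1]. *)
Lemma error_not_slack (K : numClosedFieldType) (a b k L : nat) (J : K)
    (F G Q Z : {poly {poly K}}) :
  (0 < a)%N -> (0 < b)%N -> coprime a b -> (0 < k)%N ->
  (size F <= (a * k).+1)%N -> (size F`_(a * k)%N)%R = (a * L).+1 ->
  (size G <= (b * k).+1)%N -> G`_(b * k) != 0 ->
  (size Q <= k.+1)%N -> F = Q ^+ a + Z -> Z != 0 ->
  F^`() * inner_deriv G - inner_deriv F * G^`() = J%:P%:P ->
  ~ slack a b k ((a + b) * k).-1 (a * k - (size Z).-1) L (size (lead_coef Z)).-1.
Proof.
move=> a0 b0 cab k0 sF sFt sG Gt sQ FE Z0 hJ sl.
have sZ : (size Z <= (a * k).+1)%N.
  have -> : Z = F - Q ^+ a by rewrite FE addrC addKr.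
  apply: leq_trans (size_polyD _ _) _.
  by rewrite size_polyN geq_max sF size_exp_le.
have sZ0 : (0 < size Z)%N by rewrite size_poly_gt0.
have dZ : ((size Z).-1 <= a * k)%N by move: (size Z) sZ sZ0; lia.
have nE : size Z = (size Z).-1.+1 by rewrite prednK.
move: dZ sl nE; rewrite [lead_coef Z]lead_coefE.
move: (size Z).-1 => n dZ sl nE.
apply: (@no_node K a b a0 b0 cab k ((a + b) * k).-1 (a * k - n) L
  (rev_poly (a * k) F) (rev_poly (b * k) G) (rev_poly k Q) (rev_poly n Z)).
split=> //.
- by rewrite -subn1 subn_gt0; apply: leq_trans (leq_mul (leq_add a0 b0) k0).
- rewrite FE rev_polyD rev_polyX //; congr (_ + _); apply/polyP => j.
  rewrite coefXnM !coef_rev; case: (ltnP j (a * k - n)) => hj.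
    by rewrite ifT ?nth_default ?nE //; clear -hj; lia.
  have -> : (j - (a * k - n) <= n)%N = (j <= a * k)%N by clear -dZ hj; lia.
  case: leqP => // jk.
  by have -> : (n - (j - (a * k - n)) = a * k - j)%N by clear -dZ hj jk; lia.
- exists J; rewrite mulnDl; apply: jac_rev => //.
  by rewrite addn_gt0 muln_gt0 a0 k0.
- by rewrite coef_rev subn0.
- by rewrite coef_rev subn0 -[n]/(n.+1.-1) -nE -lead_coefE lead_coef_eq0.
- by rewrite coef_rev subn0.
by rewrite coef_rev subn0.
Qed.

(** * Convex hulls and lattice points *)

Section Hulls.
Local Open Scope classical_set_scope.
Variable R : realType.

Definition box (m n : nat) : set (R * R) :=
  [set p | (0 <= p.1 <= m%:R) && (0 <= p.2 <= n%:R)].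

Lemma conv_hull_box m n (S : set (R * R)) : S `<=` box m n ->
  conv_hull S `<=` box m n.
Proof.
move=> Sb p [k [t [v [t0 t1 Sv ->]]]] /=.
have mean (c : 'I_k -> R) (M : R) : (forall i, 0 <= c i <= M) ->
    0 <= \sum_(i < k) t i * c i <= M.
  move=> hc; apply/andP; split.
    by apply: sumr_ge0 => i _; rewrite mulr_ge0 //; case/andP: (hc i).
  rewrite -[M]mul1r -t1 mulr_suml; apply: ler_sum => i _.
  by apply: ler_wpM2l => //; case/andP: (hc i).
by apply/andP; split;
  [apply: (mean (fun i => (v i).1)) | apply: (mean (fun i => (v i).2))];
  move=> i; case/andP: (Sb _ (Sv i)).
Qed.

(** Also when [m] or [n] vanishes, since division by zero gives the weight zero. *)
Lemma Rect_box m n : @Rect R m n = box m n.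
Proof.
apply/seteqP; split.
  apply: conv_hull_box => p /= [q hq <-]; rewrite /pt /box /=.
  by case: hq => [[[->|->]|->]|->] /=; rewrite ?lexx ?ler0n.
move=> [x y] /= /andP [/andP [x0 xm] /andP [y0 yn]].
pose s := x / m%:R; pose r := y / n%:R.
have frac (w : R) l : 0 <= w -> w <= l%:R -> 
    [/\ 0 <= w / l%:R, w / l%:R <= 1 & w = w / l%:R * l%:R].
  move=> w0 wl; case: l wl => [|l] wl.
    have -> : w = 0 by apply/eqP; rewrite eq_le w0 andbT.
    by rewrite !mul0r; split; rewrite ?lexx ?ler01.
  split; [by rewrite divr_ge0 | by rewrite ler_pdivrMr ?ltr0Sn // mul1r |].
  by rewrite divfK // pnatr_eq0.
have [s0 s1 xE] := frac x m x0 xm; have [r0 r1 yE] := frac y n y0 yn.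
rewrite -/s in s0 s1 xE; rewrite -/r in r0 r1 yE.
pose ts := [:: (1 - s) * (1 - r); s * (1 - r); s * r; (1 - s) * r].
pose vs : seq (R * R) := [:: (0, 0); (m%:R, 0); (m%:R, n%:R); (0, n%:R)].
exists 4%N, (fun i => nth 0 ts i), (fun i => nth (0, 0) vs i); split.
- have ? : 0 <= 1 - s by rewrite subr_ge0.
  have ? : 0 <= 1 - r by rewrite subr_ge0.
  by move=> [[|[|[|[|i]]]] //= _]; rewrite mulr_ge0.
- rewrite !big_ord_recl big_ord0 /=; ring.
- move=> [[|[|[|[|i]]]] //= _].
  + by exists (0, 0)%N => //; do 3 left.
  + by exists (m, 0)%N => //; left; left; right.
  + by exists (m, n)%N => //; left; right.
  + by exists (0, n)%N => //; right.
- rewrite !big_ord_recl !big_ord0 /= {1}xE {1}yE; congr (_, _); ring.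
Qed.

Lemma supp_N0 (f : Cxy R) q : supp f q -> N0 f (pt R q).
Proof.
move=> fq; exists 1%N, (fun=> 1), (fun=> pt R q); split=> //.
- by rewrite big_ord1.
- by move=> _; left; exists q.
by rewrite !big_ord1 !mul1r; case: (pt R q).
Qed.

Lemma N0_sub_Rect (f : Cxy R) m n :
  (forall i j, f`_i`_j != 0 -> (i <= m)%N && (j <= n)%N) -> N0 f `<=` @Rect R m n.
Proof.
move=> h; rewrite Rect_box; apply: conv_hull_box => p [[q /h /andP [q1 q2] <-]|->].
  by rewrite /box /pt /= !ler0n !ler_nat q1.
by rewrite /box /= !lexx !ler0n.
Qed.

Lemma box_nat m n i j : box m n (pt R (i, j)) -> (i <= m)%N && (j <= n)%N.
Proof. by rewrite /box /pt /= !ler0n !ler_nat. Qed.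

Lemma Rset_supp (f : Cxy R) m n : Rset m n f ->
  forall i j, f`_i`_j != 0 -> (i <= m)%N && (j <= n)%N.
Proof.
case=> e _ i j fij; apply: box_nat; rewrite -Rect_box -e.
by apply: supp_N0.
Qed.

Lemma N''_nat a k l i j : (0 < a)%N ->
  (a.-1 * k <= i <= a * k)%N -> (a.-1 * l <= j <= a * l)%N ->
  @N'' R a (a * k) (a * l) (pt R (i, j)).
Proof.
move=> a0 /andP [i1 i2] /andP [j1 j2].
exists (((i - a.-1 * k)%N)%:R, ((j - a.-1 * l)%N)%:R).
  rewrite !mulKn // Rect_box /box /= !ler0n !ler_nat /=.
  by case: a a0 i1 i2 j1 j2 => // a _; rewrite /= !mulSn; lia.
have aR : a%:R != 0 :> R by rewrite pnatr_eq0 -lt0n.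
have pa : a%:R - 1 = a.-1%:R :> R by rewrite -{1}(prednK a0) mulrSr addrK.
by rewrite /pt /= !natrB // pa !natrM; congr (_, _); field.
Qed.

End Hulls.

(** * Locating the corner *)

(** Measure positions from the corner [(a * k, a * l)]. As [k <= l], the failure of
    the second slack, with the exclusion of the top right block, places [(m1, n1)]
    weakly to the right of the diagonal through the origin, and that of the first
    places [(m2, n2)] weakly above the line through
    [(a / (a + b), a / (a + b))]. Both lines pass through the corner, the strip
    between them has horizontal width less than one, and [m1 <= m2], [n2 <= n1];
    so the two points coincide. *)
Lemma corner_arith a b k l m1 n1 m2 n2 : (1 < a)%N -> (0 < b)%N -> (0 < k)%N ->
  (k <= l)%N -> (m1 <= m2)%N -> (m2 <= a * k)%N -> (n2 <= n1)%N -> (n1 <= a * l)%N ->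
  ~~ ((a.-1 * k <= m1) && (a.-1 * l <= n1))%N ->
  ~ slack a b k ((a + b) * k).-1 (a * k - m2) l n2 ->
  ~ slack a b l ((a + b) * l).-1 (a * l - n1) k m1 ->
  (m1 = m2 -> (n1 <= n2)%N) ->
  [/\ m1 = m2, n1 = n2, (n1 < a.-1 * l)%N, (n1 * k <= m1 * l)%N &
   ((a * l - n2) * ((a + b) * k).-1 <= (a * k - m2) * ((a + b) * l).-1)%N].
Proof.
move=> a1 b0 k0 kl m12 m2k n21 n1l pre V H nn.
have l0 : (0 < l)%N by apply: leq_trans kl.
have [E1 E1E] : exists E, ((a + b) * k)%N = E.+1.
  by exists ((a + b) * k).-1; rewrite prednK // muln_gt0 k0 addn_gt0 b0 orbT.
have [E2 E2E] : exists E, ((a + b) * l)%N = E.+1.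
  by exists ((a + b) * l).-1; rewrite prednK // muln_gt0 l0 addn_gt0 b0 orbT.
have E1a : (a * k <= E1)%N by rewrite -ltnS -E1E ltn_mul2r k0 -addn1 leq_add2l.
have cross : (k * E2 + k = l * E1 + l)%N.
  by rewrite addnC -mulnS addnC -mulnS -E1E -E2E; ring.
move: V H; rewrite /slack E1E E2E /=.
move: E1a cross {E1E E2E}.
have [a' ?] : exists a', a = a'.+2 by exists a.-2; lia.
subst a; rewrite /= in pre *.
set e2 := (_ * k - m2)%N; set d1 := (_ * l - n1)%N; set d2 := (_ * l - n2)%N.
set e1 := (a'.+2 * k - m1)%N.
have e2E : (a'.+2 * k = m2 + e2)%N by rewrite /e2; lia.
have d1E : (a'.+2 * l = n1 + d1)%N by rewrite /d1; lia.
have d2E : (a'.+2 * l = n2 + d2)%N by rewrite /d2; lia.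
have e1E : (a'.+2 * k = m1 + e1)%N by rewrite /e1; lia.
have pk : (a'.+1 * k + k = m1 + e1)%N by rewrite -e1E; ring.
have pl : (a'.+1 * l + l = n1 + d1)%N by rewrite -d1E; ring.
move: (a'.+1 * k)%N (a'.+1 * l)%N pk pl pre => ak1 al1 pk pl pre E1a cross V H.
have {}H : [\/ (e1 <= k)%N, (e1 * l <= d1 * k)%N | (e1 * E2 <= d1 * E1)%N].
  have [h1|h1] := leqP e1 k; first exact: Or31.
  have [h2|h2] := leqP (e1 * l)%N (d1 * k)%N; first exact: Or32.
  have [h3|h3] := leqP (e1 * E2)%N (d1 * E1)%N; first exact: Or33.
  case: H; split; first by lia.
    by rewrite e1E mulnDl; lia.
  by rewrite e1E mulnDl mulnS; lia.
have {}V : [\/ (d2 <= l)%N, (d2 * k <= e2 * l)%N | (d2 * E1 <= e2 * E2)%N].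
  have [h1|h1] := leqP d2 l; first exact: Or31.
  have [h2|h2] := leqP (d2 * k)%N (e2 * l)%N; first exact: Or32.
  have [h3|h3] := leqP (d2 * E1)%N (e2 * E2)%N; first exact: Or33.
  case: V; split; first by lia.
    by rewrite d2E mulnDl; lia.
  by rewrite d2E mulnDl mulnS; lia.
have E10 : (0 < E1)%N by apply: leq_trans E1a; rewrite muln_gt0.
have E20 : (0 < E2)%N.
  rewrite lt0n; apply/negP => /eqP E20; move: cross; rewrite E20 muln0.
  have : (0 < l * E1)%N by rewrite muln_gt0 l0.
  by lia.
have dl : (l < d1)%N.
  rewrite ltnNge; apply/negP => dl.
  have ek : (k < e1)%N by move: pre; lia.
  case: H => h; first by lia.
    have h1 : (d1 * k <= l * k)%N by rewrite leq_mul2r dl orbT.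
    have h2 : (k.+1 * l <= e1 * l)%N by rewrite leq_mul2r ek orbT.
    by move: h2; rewrite mulSn [(k * l)%N]mulnC; lia.
  have h1 : (d1 * E1 <= l * E1)%N by rewrite leq_mul2r dl orbT.
  have h2 : (k.+1 * E2 <= e1 * E2)%N by rewrite leq_mul2r ek orbT.
  by move: h2; rewrite mulSn; lia.
(* The line through [(a / (a + b), a / (a + b))] is at least as steep as the
   diagonal. *)
have lek : (l * E1 <= k * E2)%N by clear -cross kl; lia.
have H' : (e1 * l <= d1 * k)%N.
  case: H => // h.
    apply: (@leq_trans (k * l)%N); first by rewrite leq_mul2r h orbT.
    by rewrite mulnC leq_mul2r (ltnW dl) orbT.
  rewrite -(leq_pmul2r E20); apply: (@leq_trans (d1 * E1 * l)%N).
    by rewrite mulnAC leq_mul2r h orbT.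
  by rewrite -!mulnA leq_mul2l [(E1 * l)%N]mulnC lek orbT.
have dd : (d1 <= d2)%N by clear -n21 d1E d2E; lia.
have V' : (d2 * E1 <= e2 * E2)%N.
  case: V => // h.
    by move: (leq_trans dl (leq_trans dd h)); rewrite ltnn.
  rewrite -(leq_pmul2r k0); apply: (@leq_trans (e2 * l * E1)%N).
    by rewrite mulnAC leq_mul2r h orbT.
  by rewrite -!mulnA leq_mul2l [(E2 * k)%N]mulnC lek orbT.
have e12 : e1 = e2.
  have [le|lt] := leqP e1 e2; first by clear -le m12 e1E e2E; lia.
  have h1 : (e2.+1 * l * E1 <= e2 * E2 * k)%N.
    apply: (@leq_trans (e1 * l * E1)%N); first by rewrite !leq_mul2r lt !orbT.
    apply: (@leq_trans (d1 * k * E1)%N); first by rewrite leq_mul2r H' orbT.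
    rewrite mulnAC leq_mul2r; apply/orP; right; apply: leq_trans V'.
    by rewrite leq_mul2r dd orbT.
  have h2 : (e2 * (k * E2) + e2 * k = e2 * (l * E1) + e2 * l)%N.
    by rewrite -!mulnDr cross.
  have h3 : (l * E1 + e2 * (l * E1) <= e2 * (k * E2))%N.
    by move: h1; rewrite -!mulnA mulSn [(E2 * k)%N]mulnC.
  have : (e2 * l < E1 * l)%N.
    rewrite ltn_mul2r l0; apply: leq_trans E1a; apply: leq_trans lt _.
    by clear -e1E; lia.
  by clear -h2 h3; rewrite [(E1 * l)%N]mulnC; lia.
have em : m1 = m2 by lia.
have en : n1 = n2 by have := nn em; lia.
split=> //; first by clear -pl dl; lia.
have : ((m1 + e1) * l = (n1 + d1) * k)%N by rewrite -e1E -d1E mulnAC.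
by rewrite !mulnDl; clear -H'; lia.
Qed.

Lemma inner_deriv_swapXY (S : comNzRingType) (f : {poly {poly S}}) :
  inner_deriv (swapXY f) = swapXY f^`().
Proof. by rewrite inner_deriv_swap swapXYK. Qed.

Lemma deriv_swapXY (S : comNzRingType) (f : {poly {poly S}}) :
  (swapXY f)^`() = swapXY (inner_deriv f).
Proof. by rewrite inner_deriv_swap swapXYK. Qed.

Lemma jac_swap (S : comNzRingType) (F G : {poly {poly S}}) (J : S) :
  F^`() * inner_deriv G - inner_deriv F * G^`() = J%:P%:P ->
  (swapXY F)^`() * inner_deriv (swapXY G) - inner_deriv (swapXY F) * (swapXY G)^`()
    = (- J)%:P%:P.
Proof.
move=> h; rewrite !deriv_swapXY !inner_deriv_swapXY.
rewrite -2!(swapXY_is_multiplicative S).1 -swapXY_is_zmod_morphism.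
have -> : inner_deriv F * G^`() - F^`() * inner_deriv G = (- J)%:P%:P.
  by rewrite !polyCN -h opprB.
by rewrite swapXY_polyC map_polyC.
Qed.

Lemma size_le_supp (S : nzRingType) (p : {poly S}) n :
  (forall i, p`_i != 0 -> (i <= n)%N) -> (size p <= n.+1)%N.
Proof.
move=> h; apply/leq_sizeP => j nj; apply/eqP; apply: contraTT nj => /h.
by rewrite -leqNgt.
Qed.

Lemma coef_neq0 (S : nzRingType) (f : {poly {poly S}}) i j :
  f`_i`_j != 0 -> f`_i != 0.
Proof. by apply: contraNneq => ->; rewrite coef0. Qed.

Lemma neq0_coef (S : nzRingType) (p : {poly S}) :
  p != 0 -> p`_(size p).-1 != 0.
Proof. by rewrite -lead_coefE lead_coef_eq0. Qed.

Lemma size_outer (S : nzRingType) (f : {poly {poly S}}) m n :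
  (forall i j, f`_i`_j != 0 -> (i <= m)%N && (j <= n)%N) ->
  (size f <= m.+1)%N.
Proof.
move=> h; apply: size_le_supp => i /neq0_coef /h /andP [] //.
Qed.

Lemma size_corner (S : nzRingType) (f : {poly {poly S}}) m n :
  (forall i j, f`_i`_j != 0 -> (i <= m)%N && (j <= n)%N) ->
  f`_m`_n != 0 -> size f`_m = n.+1.
Proof.
move=> h fmn; apply/eqP; rewrite eqn_leq; apply/andP; split.
  by apply: size_le_supp => j /h /andP [].
by rewrite ltnNge; apply: contra fmn => /leq_sizeP ->.
Qed.

(** The slope in [frakR] is the ratio of [(a + b) * l - 1] to [(a + b) * k - 1]. *)
Lemma frakR_pt (R : realType) a b k l m n :
  (1 < a)%N -> (0 < b)%N -> (0 < k)%N -> (0 < l)%N ->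
  (m <= a * k)%N -> (n <= a * l)%N ->
  (n < a.-1 * l)%N -> (n * k <= m * l)%N ->
  ((a * l - n) * ((a + b) * k).-1 <= (a * k - m) * ((a + b) * l).-1)%N ->
  frakR a b (a * k) (a * l) (pt R (m, n)).
Proof.
move=> a1 b0 k0 l0 mk nl nal nm strip.
have a0 : (0 < a)%N by apply: ltnW.
have aR : 0 < a%:R :> R by rewrite ltr0n.
have kR : 0 < k%:R :> R by rewrite ltr0n.
have lR : 0 < l%:R :> R by rewrite ltr0n.
have abR : 0 < (a + b)%:R :> R by rewrite ltr0n addn_gt0 a0.
have pred_cast x : (0 < x)%N -> ((a + b) * x).-1%:R = (a + b)%:R * x%:R - 1 :> R.
  move=> x0; have : (0 < (a + b) * x)%N by rewrite muln_gt0 addn_gt0 a0 x0.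
  by move=> /prednK e; rewrite -natrM -{2}e mulrSr addrK.
have E0 : 0 < (a + b)%:R * k%:R - 1 :> R.
  rewrite -pred_cast // ltr0n -subn1 subn_gt0.
  by apply: leq_trans (leq_mul (leq_add a0 b0) k0).
have aN0 : a%:R != 0 :> R by rewrite gt_eqF.
have abN0 : (a + b)%:R != 0 :> R by rewrite gt_eqF.
have EN0 : (a + b)%:R * k%:R - 1 != 0 :> R by rewrite gt_eqF.
rewrite /frakR /pt /=; split; apply/andP; split.
- by rewrite ler0n.
- have -> : (a%:R - 1) / a%:R * (a * l)%:R = (a.-1 * l)%:R :> R.
    have -> : a%:R - 1 = a.-1%:R :> R by rewrite -{1}(prednK a0) mulrSr addrK.
    by rewrite !natrM; field.
  by rewrite ltr_nat.
- have cm : (a * k)%:R - a%:R / (a + b)%:R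
      = a%:R * ((a + b)%:R * k%:R - 1) / (a + b)%:R :> R.
    by rewrite natrM; move: (a + b)%:R abN0 => s sN0; field.
  have cl : (a * l)%:R - a%:R / (a + b)%:R
      = a%:R * ((a + b)%:R * l%:R - 1) / (a + b)%:R :> R.
    by rewrite natrM; move: (a + b)%:R abN0 => s sN0; field.
  rewrite cm cl.
  have -> : a%:R * ((a + b)%:R * l%:R - 1) / (a + b)%:R
      / (a%:R * ((a + b)%:R * k%:R - 1) / (a + b)%:R)
     = ((a + b)%:R * l%:R - 1) / ((a + b)%:R * k%:R - 1) :> R.
    by move: (a + b)%:R abN0 EN0 => s sN0 EN0; field; rewrite EN0 aN0 sN0.
  move: strip; rewrite -(ler_nat R) !natrM !natrB // !pred_cast // !natrM => st.
  rewrite -lerBrDr mulrAC ler_pdivrMr // -subr_ge0.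
  rewrite -subr_ge0 in st.
  rewrite [X in 0 <= X](_ : _ =
     (a%:R * k%:R - m%:R) * ((a + b)%:R * l%:R - 1) -
     (a%:R * l%:R - n%:R) * ((a + b)%:R * k%:R - 1)) //.
  by move: (a + b)%:R abN0 => s sN0; field.
- rewrite mulrAC ler_pdivlMr ?ltr0n ?muln_gt0 ?a0 // -!natrM ler_nat.
  by rewrite mulnCA -mulnA leq_mul2l [(l * m)%N]mulnC nm orbT.
Qed.

Theorem corollary5p10 (R : realType) (a b m n : nat) (F G zeta : Cxy R)
  (habmn : calQ a b m n) (hmn : (m <= n)%N)
  (hF : Rset m n F)
  (hG : Rset (b * m %/ a)%N (b * n %/ a)%N G)
  (hFG : is_constXY (bracket F G))
  (hzeta : is_inner a m n F zeta) :
  zeta = 0%R \/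
  exists m' n' : nat, Rbar m' n' zeta /\ frakR a b m n (pt R (m', n')).
Proof.
have [z0|z0] := eqVneq zeta 0; [by left | right].
have [[a0 b0 m0 n0] am an cab /andP [a2 ab]] := habmn.
have [k mE] : exists k, m = (a * k)%N.
  by exists (m %/ a)%N; rewrite mulnC divnK.
have [l nE] : exists l, n = (a * l)%N.
  by exists (n %/ a)%N; rewrite mulnC divnK.
subst m n.
have k0 : (0 < k)%N by move: m0; rewrite muln_gt0 => /andP [].
have l0 : (0 < l)%N by move: n0; rewrite muln_gt0 => /andP [].
have kl : (k <= l)%N by rewrite -(leq_pmul2l a0).
rewrite !(mulnCA b a) !mulKn // in hG.
have [Q [hQ hdiff] zE] := hzeta; rewrite !mulKn // -zE in hQ hdiff.
have sF := Rset_supp hF; have sG := Rset_supp hG; have sQ := Rset_supp hQ.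
have FE : F = Q ^+ a + zeta by rewrite zE addrC subrK.
have sz i j : zeta`_i`_j != 0 -> (i <= a * k)%N && (j <= a * l)%N.
  move=> zij; apply: (@box_nat R); rewrite -Rect_box -hF.1.
  by case: (hdiff (pt R (i, j))) => //; exists (i, j).
have pre i j : zeta`_i`_j != 0 -> ~~ ((a.-1 * k <= i) && (a.-1 * l <= j))%N.
  move=> zij; apply/negP => /andP [ik jl].
  have /andP [ik' jl'] := sz _ _ zij.
  case: (hdiff (pt R (i, j))); first by exists (i, j).
  by move=> _; apply; apply: N''_nat; rewrite ?ik ?jl.
have [J hJ] : exists J : R[i],
  F^`() * inner_deriv G - inner_deriv F * G^`() = J%:P%:P := hFG.
have swap_supp (f : Cxy R) x y : (forall i j, f`_i`_j != 0 -> (i <= x)%N && (j <= y)%N) ->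
    forall i j, (swapXY f)`_i`_j != 0 -> (i <= y)%N && (j <= x)%N.
  by move=> h i j; rewrite coef_swapXY andbC => /h.
(* [(m2, n2)] tops the rightmost column of [zeta], and [(m1, n1)] ends its top
   row. *)
pose m2 := (size zeta).-1; pose n2 := (size zeta`_m2).-1.
pose n1 := (size (swapXY zeta)).-1; pose m1 := (size (swapXY zeta)`_n1).-1.
have sw0 : swapXY zeta != 0 by rewrite swapXY_eq0.
have z2 : zeta`_m2`_n2 != 0 by apply/neq0_coef/neq0_coef.
have z1 : zeta`_m1`_n1 != 0 by rewrite -coef_swapXY; apply/neq0_coef/neq0_coef.
have bnd i j : zeta`_i`_j != 0 -> (i <= m2)%N && (j <= n1)%N.
  move=> zij; apply/andP; split.
    rewrite -ltnS prednK ?size_poly_gt0 // ltnNge.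
    by apply: contra zij => /leq_sizeP -> //; rewrite coef0.
  move: zij; rewrite -coef_swapXY => zij.
  rewrite -ltnS prednK ?size_poly_gt0 // ltnNge.
  by apply: contra zij => /leq_sizeP -> //; rewrite coef0.
have /andP [m2k n2l] := sz _ _ z2; have /andP [m1k n1l] := sz _ _ z1.
have /andP [_ n21] := bnd _ _ z2; have /andP [m12 _] := bnd _ _ z1.
have F1 : F`_(a * k)`_(a * l) != 0 by rewrite hF.2 oner_eq0.
have G1 : G`_(b * k)`_(b * l) != 0 by rewrite hG.2 oner_eq0.
have V : ~ slack a b k ((a + b) * k).-1 (a * k - m2) l n2.
  apply: (error_not_slack a0 b0 cab k0 _ _ _ _ _ FE z0 hJ).
  - exact: size_outer sF.
  - exact: size_corner sF F1.
  - exact: size_outer sG.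
  - exact: coef_neq0 G1.
  - exact: size_outer sQ.
have H : ~ slack a b l ((a + b) * l).-1 (a * l - n1) k m1.
  have FE' : swapXY F = swapXY Q ^+ a + swapXY zeta.
    by rewrite FE rmorphD rmorphXn.
  have F1' : (swapXY F)`_(a * l)`_(a * k) != 0 by rewrite coef_swapXY.
  have G1' : (swapXY G)`_(b * l)`_(b * k) != 0 by rewrite coef_swapXY.
  apply: (error_not_slack a0 b0 cab l0 _ _ _ _ _ FE' sw0 (jac_swap hJ)).
  - exact: size_outer (swap_supp _ _ _ sF).
  - exact: size_corner (swap_supp _ _ _ sF) F1'.
  - exact: size_outer (swap_supp _ _ _ sG).
  - exact: coef_neq0 G1'.
  - exact: size_outer (swap_supp _ _ _ sQ).
have nn : m1 = m2 -> (n1 <= n2)%N.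
  move=> e; rewrite e in z1.
  rewrite -[(n1 <= n2)%N]ltnS /n2 prednK ?size_poly_gt0 ?(coef_neq0 z1) //.
  rewrite ltnNge.
  by apply: contra z1 => /leq_sizeP ->.
have [em en nal nm strip] :=
  corner_arith a2 b0 k0 kl m12 m2k n21 n1l (pre _ _ z1) V H nn.
exists m2, n2; split; last first.
  by apply: frakR_pt => //; rewrite -?en -?em // ?em // ?en.
by split=> //; apply: N0_sub_Rect => i j /bnd; rewrite en.
Qed.
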